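(* Let $\{u_s^{n}\}_{n\ge 0}$ be generated by the sETDMs2 scheme (defined in the context) with stabilization constant $A$, and assume that $A\geq \frac{2+\sqrt{3}}{6}$. Then the scheme is energy stable in the sense that for every $1\le n\le N_t-1$, $$\tilde{E}(u_s^{n+1}) + \left(A-\frac{2+\sqrt{3}}{6}\right)\tau^2\int_{t_n}^{t_{n+1}}\left\|\frac{\mathrm{d}\,\Delta_{\mathcal N} u_s^{n+1}(t)}{\mathrm{d} t}\right\|_{\mathcal N}^2\,\mathrm{d}t \;\leq\; \tilde{E}(u_s^{n}),$$ where, for $0\le n\le N_t-1$, $$\tilde{E}(u_s^{n+1})= E_{\mathcal{N}}(u_s^{n+1}(t_{n+1})) +\frac{\sqrt{3}-1}{4} \int_{t_n}^{t_{n+1}}\left\|\frac{\mathrm{d} u_s^{n+1}(t)}{\mathrm{d} t}\right\|_{\mathcal N}^2\mathrm{d}t + \frac{(\sqrt{3}+1)\tau^2}{24}\int_{t_n}^{t_{n+1}}\left\|\frac{\mathrm{d}\, \Delta_{\mathcal{N}} u_s^{n+1}(t)}{\mathrm{d} t}\right\|_{\mathcal N}^2\mathrm{d}t .$$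
   Context: Setting: $\Omega=[0,L]^2$, $\varepsilon>0$ and $T>0$ are constants, $N$ and $N_t$ are positive integers, $h=\frac{L}{2N}$, $\tau=\frac{T}{N_t}$, $t_n=n\tau$. Grid points are $(x_i,y_j)=(ih,jh)$, $0\le i,j\le 2N$. $\mathcal{M}^{\mathcal N}$ is the space of 2D periodic grid functions on this grid. For $f\in\mathcal M^{\mathcal N}$ put, for $-N+1\le k,l\le N$, $(\hat f_c)_{k,l}=\frac{1}{4N^2}\sum_{i,j=1}^{2N} f(x_i,y_j)\exp(-\frac{2\pi \mathrm{i}}{L}(kx_i+ly_j))$. Discrete derivative: $(D_xf)_{i,j}=\sum_{k,l=-N+1}^{N}\frac{2k\pi \mathrm{i}}{L}(\hat f_c)_{k,l}\exp(\frac{2\pi \mathrm{i}}{L}(kx_i+ly_j))$, $(D_x^2f)_{i,j}=\sum_{k,l=-N+1}^{N}-\frac{4k^2\pi^2}{L^2}(\hat f_c)_{k,l}\exp(\frac{2\pi \mathrm{i}}{L}(kx_i+ly_j))$, and $D_y,D_y^2$ similarly. Set $\nabla_{\mathcal N}f=(D_xf,D_yf)^T$, $\nabla_{\mathcal N}\cdot(f^1,f^2)^T=D_xf^1+D_yf^2$, $\Delta_{\mathcal N}=D_x^2+D_y^2$. Inner product and norm: grid functions may take complex values, $(f,g)_{\mathcal N}=h^2\sum_{i,j=1}^{2N}f_{ij}\overline{g_{ij}}$, $\|f\|_{\mathcal N}=\sqrt{(f,f)_{\mathcal N}}$. $\mathcal M_0^{\mathcal N}=\{v\in\mathcal M^{\mathcal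 N}: (v,1)_{\mathcal N}=0\}$. For a vector $\mathbf v$, $|\mathbf v|$ is its Euclidean norm (modulus), pointwise on the grid. Nonlinear term: $f_{\mathcal N}(v)=\nabla_{\mathcal N}\cdot\left(\frac{\nabla_{\mathcal N}v}{1+|\nabla_{\mathcal N}v|^2}\right)$, and $f_{\mathcal N,L}(s,v,w)=f_{\mathcal N}(v)+\frac{s}{\tau}[f_{\mathcal N}(v)-f_{\mathcal N}(w)]$ for $s\in[0,\tau]$. Discrete energy: $E_{\mathcal N}(v)=\left(-\frac12\ln(1+|\nabla_{\mathcal N}v|^2),1\right)_{\mathcal N}+\frac{\varepsilon^2}{2}\|\Delta_{\mathcal N}v\|_{\mathcal N}^2$. sETDMs2 scheme (with constant $A>0$): $u_s^0=u(0)\in\mathcal M_0^{\mathcal N}$ is the given initial grid function. The initial step is the (continuous) function $u_s^1:[0,t_1]\to\mathcal M_0^{\mathcal N}$ with $u_s^1(0)=u_s^0$ and $$\frac{\mathrm d u_s^1(t)}{\mathrm dt}+A\tau^2\frac{\mathrm d\,\Delta_{\mathcal N}^2u_s^1(t)}{\mathrm dt}=-\varepsilon^2\Delta_{\mathcal N}^2u_s^1(t)-f_{\mathcal N}(u_s^0),\quad t\in(0,t_1].$$ For $n\ge1$, $u_s^{n+1}:[0,t_{n+1}]\to\mathcal M_0^{\mathcal N}$ is the continuous function with $u_s^{n+1}(t)=u_s^n(t)$ on $[0,t_n]$ and $$\frac{\mathrm d u_s^{n+1}(t)}{\mathrm dt}+A\tau^2\frac{\mathrm d\,\Delta_{\mathcal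 N}^2u_s^{n+1}(t)}{\mathrm dt}=-\varepsilon^2\Delta_{\mathcal N}^2u_s^{n+1}(t)-f_{\mathcal N,L}(t-t_n,u_s^n,u_s^{n-1}),\quad t\in(t_n,t_{n+1}],$$ where, written without a time argument, $u_s^{n}$ denotes the value $u_s^{n}(t_{n})$. *)

(* Defs.v *)
From Stdlib Require Import Reals ZArith.
From Coquelicot Require Import Coquelicot.

Open Scope R_scope.

(* Node (x_i, y_j) is indexed by (i, j); indices run over all of Z and
   periodicity identifies i with i + 2N, so {0..2N} covers [0,L]^2. *)
Definition grid_fun := Z -> Z -> C.

Definition grid_eq (f g : grid_fun) : Prop := forall i j : Z, f i j = g i j.

Definition periodic (N : nat) (f : grid_fun) : Prop :=
  forall i j : Z,
    f (i + 2 * Z.of_nat N)%Z j = f i j /\ f i (j + 2 * Z.of_nat N)%Z = f i j.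

Definition gadd (f g : grid_fun) : grid_fun := fun i j => (f i j + g i j)%C.
Definition gsub (f g : grid_fun) : grid_fun := fun i j => (f i j - g i j)%C.
Definition gscal (a : R) (f : grid_fun) : grid_fun :=
  fun i j => (RtoC a * f i j)%C.

Definition mesh (L : R) (N : nat) : R := L / (2 * INR N).
Definition node (L : R) (N : nat) (i : Z) : R := IZR i * mesh L N.

Definition grid_sum (N : nat) (F : grid_fun) : C :=
  sum_n_m (fun i => sum_n_m (fun j => F (Z.of_nat i) (Z.of_nat j))
                            1 (2 * N)) 1 (2 * N).

(* The shift by N turns 1..2N into the frequencies -N+1..N. *)
Definition freq_sum (N : nat) (F : Z -> Z -> C) : C :=
  grid_sum N (fun k l => F (k - Z.of_nat N)%Z (l - Z.of_nat N)%Z).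

(* e^{i theta} *)
Definition expi (theta : R) : C := (cos theta, sin theta).

Definition phase (L : R) (N : nat) (k l i j : Z) : R :=
  2 * PI / L * (IZR k * node L N i + IZR l * node L N j).

Definition fourier_coef (L : R) (N : nat) (f : grid_fun) (k l : Z) : C :=
  (RtoC (/ (4 * INR N ^ 2)) *
   grid_sum N (fun i j => f i j * expi (- phase L N k l i j)))%C.

Definition fourier_mult (L : R) (N : nat) (m : Z -> Z -> C) (f : grid_fun) :
  grid_fun :=
  fun i j => freq_sum N (fun k l =>
    (m k l * fourier_coef L N f k l * expi (phase L N k l i j))%C).

Definition Dx (L : R) (N : nat) : grid_fun -> grid_fun :=
  fourier_mult L N (fun k _ => (RtoC (2 * IZR k * PI / L) * Ci)%C).
Definition Dy (L : R) (N : nat) : grid_fun -> grid_fun :=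
  fourier_mult L N (fun _ l => (RtoC (2 * IZR l * PI / L) * Ci)%C).
Definition Dx2 (L : R) (N : nat) : grid_fun -> grid_fun :=
  fourier_mult L N (fun k _ => RtoC (- (4 * IZR k ^ 2 * PI ^ 2 / L ^ 2))).
Definition Dy2 (L : R) (N : nat) : grid_fun -> grid_fun :=
  fourier_mult L N (fun _ l => RtoC (- (4 * IZR l ^ 2 * PI ^ 2 / L ^ 2))).

Definition grad (L : R) (N : nat) (f : grid_fun) : grid_fun * grid_fun :=
  (Dx L N f, Dy L N f).
Definition div (L : R) (N : nat) (F : grid_fun * grid_fun) : grid_fun :=
  gadd (Dx L N (fst F)) (Dy L N (snd F)).
Definition laplacian (L : R) (N : nat) (f : grid_fun) : grid_fun :=
  gadd (Dx2 L N f) (Dy2 L N f).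
Definition bilaplacian (L : R) (N : nat) (f : grid_fun) : grid_fun :=
  laplacian L N (laplacian L N f).

Definition inner (L : R) (N : nat) (f g : grid_fun) : C :=
  (RtoC (mesh L N ^ 2) * grid_sum N (fun i j => f i j * Cconj (g i j)))%C.

(* (f, f) is a nonnegative real number, so taking Re loses nothing. *)
Definition gnorm (L : R) (N : nat) (f : grid_fun) : R :=
  sqrt (Re (inner L N f f)).

Definition gone : grid_fun := fun _ _ => RtoC 1.

Definition zero_mean (L : R) (N : nat) (v : grid_fun) : Prop :=
  periodic N v /\ inner L N v gone = RtoC 0.

Definition vmod (F : grid_fun * grid_fun) (i j : Z) : R :=
  sqrt (Cmod (fst F i j) ^ 2 + Cmod (snd F i j) ^ 2).

Definition fN (L : R) (N : nat) (v : grid_fun) : grid_fun :=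
  let G := grad L N v in
  let w i j := RtoC (1 + vmod G i j ^ 2) in
  div L N (fun i j => (fst G i j / w i j)%C, fun i j => (snd G i j / w i j)%C).

Definition fNL (L : R) (N : nat) (tau s : R) (v w : grid_fun) : grid_fun :=
  gadd (fN L N v) (gscal (s / tau) (gsub (fN L N v) (fN L N w))).

(* The inner product below is that of two real-valued grid functions. *)
Definition energy (L eps : R) (N : nat) (v : grid_fun) : R :=
  Re (inner L N
        (fun i j => RtoC (- (1 / 2) * ln (1 + vmod (grad L N v) i j ^ 2))) gone)
  + eps ^ 2 / 2 * gnorm L N (laplacian L N v) ^ 2.

Definition tstep (T : R) (Nt : nat) : R := T / INR Nt.
Definition tnode (T : R) (Nt n : nat) : R := INR n * tstep T Nt.

(* [dw] is the time derivative at [t] of the path [w] with domain [0, b]: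
   two-sided when 0 < t < b, one-sided at the end points. *)
Definition is_time_deriv (b : R) (w : R -> grid_fun) (t : R) (dw : grid_fun) :
  Prop :=
  forall i j : Z,
    @filterdiff R_AbsRing R_NormedModule C_R_NormedModule
      (fun s => w s i j) (within (fun s => 0 <= s <= b) (locally t))
      (fun y => scal y (dw i j)).

(* Total version, used only under integrals over [t_(n-1), t_n]: it agrees with
   [is_time_deriv] inside the interval, and [RInt] ignores the end points. *)
Definition time_deriv (w : R -> grid_fun) (t : R) : grid_fun :=
  fun i j => (Derive (fun s => Re (w s i j)) t, Derive (fun s => Im (w s i j)) t).

(* du/dt + A tau^2 d(Delta^2 u)/dt = - eps^2 Delta^2 u - g on (a, b]. *)
Definition solves_step (L eps A tau : R) (N : nat) (a b : R)
    (u g : R -> grid_fun) : Prop :=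
  forall t : R, a < t <= b ->
    exists du dbu : grid_fun,
      is_time_deriv b u t du /\
      is_time_deriv b (fun s => bilaplacian L N (u s)) t dbu /\
      grid_eq (gadd du (gscal (A * tau ^ 2) dbu))
              (gsub (gscal (- eps ^ 2) (bilaplacian L N (u t))) (g t)).

(* [u n] is the function u_s^n on [0, t_n], left unspecified elsewhere;
   the grid function u_s^n without time argument is [u n (tnode T Nt n)].
   As t_0 = 0, [u 0] only matters at time 0, where it is the initial datum. *)
Record sETDMs2 (L eps A T : R) (N Nt : nat) (u : nat -> R -> grid_fun) : Prop :=
{ sETDMs2_space : forall (n : nat) (t : R),
    (n <= Nt)%nat -> 0 <= t <= tnode T Nt n -> zero_mean L N (u n t);
  sETDMs2_continuous : forall n : nat, (1 <= n <= Nt)%nat ->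
    forall i j : Z,
      continuous_on (fun t => 0 <= t <= tnode T Nt n) (fun t => u n t i j);
  sETDMs2_extends : forall (n : nat) (t : R),
    (S n <= Nt)%nat -> 0 <= t <= tnode T Nt n -> grid_eq (u (S n) t) (u n t);
  sETDMs2_first :
    solves_step L eps A (tstep T Nt) N (tnode T Nt 0) (tnode T Nt 1) (u 1%nat)
      (fun _ => fN L N (u 0%nat (tnode T Nt 0)));
  sETDMs2_next : forall n : nat, (1 <= n)%nat -> (S n <= Nt)%nat ->
    solves_step L eps A (tstep T Nt) N (tnode T Nt n) (tnode T Nt (S n)) (u (S n))
      (fun t => fNL L N (tstep T Nt) (t - tnode T Nt n)
                  (u n (tnode T Nt n))
                  (u (n - 1)%nat (tnode T Nt (n - 1)))) }.

(* Integrals over [t_(n-1), t_n] of |du_s^n/dt|^2 and |d(Delta u_s^n)/dt|^2,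
   for n >= 1. *)
Definition int_dt (L T : R) (N Nt : nat) (u : nat -> R -> grid_fun) (n : nat) : R :=
  RInt (fun t => gnorm L N (time_deriv (u n) t) ^ 2)
       (tnode T Nt (n - 1)) (tnode T Nt n).
Definition int_dt_lap (L T : R) (N Nt : nat) (u : nat -> R -> grid_fun) (n : nat) : R :=
  RInt (fun t => gnorm L N (time_deriv (fun s => laplacian L N (u n s)) t) ^ 2)
       (tnode T Nt (n - 1)) (tnode T Nt n).

(* Modified energy of u_s^n, for n >= 1. *)
Definition modified_energy (L eps T : R) (N Nt : nat) (u : nat -> R -> grid_fun)
    (n : nat) : R :=
  energy L eps N (u n (tnode T Nt n))
  + (sqrt 3 - 1) / 4 * int_dt L T N Nt u n
  + (sqrt 3 + 1) * tstep T Nt ^ 2 / 24 * int_dt_lap L T N Nt u n.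

(* Main.v *)
From Stdlib Require Import Reals ZArith Lia Lra FunctionalExtensionality.
From Coquelicot Require Import Coquelicot.
Require Import Defs.

(** Write [v = u^n], [p = u^(n-1)], [U] for the new path on [[t_n, t_(n+1)]], and
    [V = U'].  Pairing the equation with [V] and integrating gives

      int |V|^2 + A tau^2 int |Delta V|^2 + eps^2/2 (|Delta U|^2 - |Delta v|^2)
        + (f(v), U - v)  =  - int (t - t_n)/tau (f(v) - f(p), V),

    with [U] at [t_(n+1)].  Two facts about the nonlinearity close the estimate.
    The potential [-1/2 ln (1 + |z|^2)] exceeds its linearization by at most
    the squared increment of [z] ([potential_increment]), so replacing
    [(f(v), U - v)] by the change of the potential costs [|grad (U - v)|^2].  The
    flux [z / (1 + |z|^2)] is 1-Lipschitz ([flux_lipschitz]), so by Young's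
    inequality the extrapolation term costs [sqrt 3/6 |grad (v - p)|^2] plus
    [sqrt 3/6 tau int |grad V|^2]; the factor [sqrt 3] balances the two, as the
    square of [(t - t_n)/tau] has mean [1/3].  This is [step_energy].

    The gradients are then traded for the dissipation.  A gradient increment over
    one step is bounded by [tau int |grad V|^2] ([grad_increment]), and
    [|grad V|^2 = - (V, Delta V)], so that expanding [|V + r tau Delta V|^2 >= 0]
    bounds [tau |grad V|^2] by [|V|^2] and [tau^2 |Delta V|^2]
    ([grad_interpolation]).  The single value [r = (3 + sqrt 3)/6] serves both
    the new and the previous step, and makes every coefficient of the
    theorem come out exactly.

    All of this takes place on a finite grid, but two points need care.  Composing
    spectral operators ([D_x D_x = D_x^2]) rests on the orthogonality of the
    discrete exponentials.  And the integrals only make sense because [V] extends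
    continuously to the closed interval: [1 + A tau^2 Delta^2] is invertible, which
    expresses [V] through the continuous right-hand side ([step_regularity]). *)

(** * Finite sums over the grid *)

Definition zsum (M : nat) (f : Z -> C) : C :=
  sum_n_m (fun i => f (Z.of_nat i)) 1 M.

Definition is_node (N : nat) (i : Z) : Prop := (1 <= i <= 2 * Z.of_nat N)%Z.

Lemma zsum_0 (f : Z -> C) : zsum 0 f = RtoC 0.
Proof. unfold zsum. rewrite sum_n_m_zero by lia. reflexivity. Qed.

Lemma zsum_S (M : nat) (f : Z -> C) :
  zsum (S M) f = (zsum M f + f (Z.of_nat (S M)))%C.
Proof. unfold zsum. rewrite sum_n_Sm by lia. reflexivity. Qed.

Lemma zsum_ext (M : nat) (f g : Z -> C) :
  (forall i, (1 <= i <= Z.of_nat M)%Z -> f i = g i) -> zsum M f = zsum M g.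
Proof. intros H. apply sum_n_m_ext_loc. intros k Hk. apply H. lia. Qed.

Lemma zsum_plus (M : nat) (f g : Z -> C) :
  zsum M (fun i => f i + g i)%C = (zsum M f + zsum M g)%C.
Proof.
  induction M as [|M IH]; [rewrite !zsum_0|rewrite !zsum_S, IH]; ring.
Qed.

Lemma zsum_mult_l (M : nat) (c : C) (f : Z -> C) :
  zsum M (fun i => c * f i)%C = (c * zsum M f)%C.
Proof.
  induction M as [|M IH]; [rewrite !zsum_0|rewrite !zsum_S, IH]; ring.
Qed.

Lemma zsum_mult_r (M : nat) (c : C) (f : Z -> C) :
  zsum M (fun i => f i * c)%C = (zsum M f * c)%C.
Proof.
  induction M as [|M IH]; [rewrite !zsum_0|rewrite !zsum_S, IH]; ring.
Qed.

Lemma zsum_zero (M : nat) : zsum M (fun _ => RtoC 0) = RtoC 0.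
Proof.
  induction M as [|M IH]; [rewrite !zsum_0|rewrite !zsum_S, IH]; ring.
Qed.

Lemma zsum_conj (M : nat) (f : Z -> C) :
  Cconj (zsum M f) = zsum M (fun i => Cconj (f i)).
Proof.
  induction M as [|M IH].
  - rewrite !zsum_0. unfold Cconj, RtoC; simpl. f_equal; ring.
  - rewrite !zsum_S, Cplus_conj, IH. reflexivity.
Qed.

Lemma zsum_swap (M P : nat) (F : Z -> Z -> C) :
  zsum M (fun i => zsum P (fun j => F i j)) =
  zsum P (fun j => zsum M (fun i => F i j)).
Proof.
  induction M as [|M IH].
  - rewrite zsum_0. rewrite (zsum_ext P _ (fun _ => RtoC 0)).
    + now rewrite zsum_zero.
    + intros; apply zsum_0.
  - rewrite zsum_S, IH, <- zsum_plus. apply zsum_ext. intros.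
    now rewrite zsum_S.
Qed.

Definition delta (i j : Z) : C := if Z.eq_dec i j then RtoC 1 else RtoC 0.

Lemma zsum_delta (M : nat) (f : Z -> C) (k : Z) :
  (1 <= k <= Z.of_nat M)%Z -> zsum M (fun i => f i * delta i k)%C = f k.
Proof.
  induction M as [|M IH]; intros Hk; [lia|].
  rewrite zsum_S. unfold delta at 2.
  destruct (Z.eq_dec (Z.of_nat (S M)) k) as [E|E].
  - rewrite (zsum_ext M _ (fun _ => RtoC 0)), zsum_zero, E.
    + ring.
    + intros i Hi. unfold delta. destruct (Z.eq_dec i k); [lia|ring].
  - rewrite IH by lia. ring.
Qed.

Lemma grid_sum_zsum (N : nat) (F : grid_fun) :
  grid_sum N F = zsum (2 * N) (fun i => zsum (2 * N) (fun j => F i j)).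
Proof. reflexivity. Qed.

Lemma grid_sum_ext (N : nat) (F G : grid_fun) :
  (forall i j, is_node N i -> is_node N j -> F i j = G i j) ->
  grid_sum N F = grid_sum N G.
Proof.
  intros H. rewrite !grid_sum_zsum. apply zsum_ext; intros i Hi.
  apply zsum_ext; intros j Hj. apply H; unfold is_node; lia.
Qed.

Lemma grid_sum_plus (N : nat) (F G : grid_fun) :
  grid_sum N (fun i j => F i j + G i j)%C = (grid_sum N F + grid_sum N G)%C.
Proof.
  rewrite !grid_sum_zsum, <- zsum_plus. apply zsum_ext; intros.
  now rewrite zsum_plus.
Qed.

Lemma grid_sum_mult_l (N : nat) (c : C) (F : grid_fun) :
  grid_sum N (fun i j => c * F i j)%C = (c * grid_sum N F)%C.
Proof.
  rewrite !grid_sum_zsum, <- zsum_mult_l. apply zsum_ext; intros.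
  now rewrite zsum_mult_l.
Qed.

Lemma grid_sum_mult_r (N : nat) (c : C) (F : grid_fun) :
  grid_sum N (fun i j => F i j * c)%C = (grid_sum N F * c)%C.
Proof.
  rewrite !grid_sum_zsum, <- zsum_mult_r. apply zsum_ext; intros.
  now rewrite zsum_mult_r.
Qed.

Lemma grid_sum_conj (N : nat) (F : grid_fun) :
  Cconj (grid_sum N F) = grid_sum N (fun i j => Cconj (F i j)).
Proof.
  rewrite !grid_sum_zsum, zsum_conj. apply zsum_ext; intros.
  now rewrite zsum_conj.
Qed.

Lemma grid_sum_swap (N : nat) (F : Z -> Z -> Z -> Z -> C) :
  grid_sum N (fun i j => grid_sum N (fun k l => F i j k l)) =
  grid_sum N (fun k l => grid_sum N (fun i j => F i j k l)).
Proof.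
  rewrite (grid_sum_zsum N).
  transitivity (zsum (2 * N) (fun i => zsum (2 * N) (fun k => zsum (2 * N)
    (fun l => zsum (2 * N) (fun j => F i j k l))))).
  - apply zsum_ext; intros i _.
    transitivity (zsum (2 * N) (fun k => zsum (2 * N) (fun j => zsum (2 * N)
      (fun l => F i j k l)))).
    + exact (zsum_swap (2 * N) (2 * N)
               (fun j k => zsum (2 * N) (fun l => F i j k l))).
    + apply zsum_ext; intros k _. apply zsum_swap.
  - rewrite zsum_swap, grid_sum_zsum. apply zsum_ext; intros k _.
    rewrite zsum_swap. reflexivity.
Qed.

Lemma grid_sum_prod (N : nat) (f g : Z -> C) :
  grid_sum N (fun i j => f i * g j)%C = (zsum (2 * N) f * zsum (2 * N) g)%C.
Proof.
  rewrite grid_sum_zsum, <- zsum_mult_r. apply zsum_ext; intros.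
  now rewrite zsum_mult_l.
Qed.

Lemma grid_sum_delta (N : nat) (F : grid_fun) (k l : Z) :
  is_node N k -> is_node N l ->
  grid_sum N (fun i j => F i j * (delta i k * delta j l))%C = F k l.
Proof.
  unfold is_node. intros Hk Hl. rewrite grid_sum_zsum.
  rewrite (zsum_ext _ _ (fun i => F i l * delta i k)%C).
  - apply (zsum_delta _ (fun i => F i l)). lia.
  - intros i _. rewrite (zsum_ext _ _ (fun j => (F i j * delta i k) * delta j l)%C).
    + apply (zsum_delta _ (fun j => F i j * delta i k)%C). lia.
    + intros; ring.
Qed.

(** * Orthogonality of the discrete exponentials *)

Lemma expi_0 : expi 0 = RtoC 1.
Proof. unfold expi. now rewrite cos_0, sin_0. Qed.

Lemma expi_plus (a b : R) : expi (a + b) = (expi a * expi b)%C.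
Proof.
  unfold expi, Cmult; simpl. rewrite cos_plus, sin_plus. f_equal; ring.
Qed.

Lemma expi_conj (a : R) : Cconj (expi a) = expi (- a).
Proof. unfold expi, Cconj; simpl. now rewrite cos_neg, sin_neg. Qed.

(** The 2N-th root of unity raised to the power [d]. *)
Definition root (N : nat) (d : Z) : C := expi (PI / INR N * IZR d).

Lemma root_0 (N : nat) : root N 0 = RtoC 1.
Proof. unfold root. rewrite Rmult_0_r. apply expi_0. Qed.

Lemma root_plus (N : nat) (a b : Z) : root N (a + b) = (root N a * root N b)%C.
Proof. unfold root. rewrite <- expi_plus, plus_IZR. f_equal; ring. Qed.

Lemma root_opp (N : nat) (a : Z) : root N (- a) = Cconj (root N a).
Proof. unfold root. rewrite expi_conj, opp_IZR. f_equal; ring. Qed.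

Lemma root_period (N : nat) (d : Z) :
  (0 < N)%nat -> root N (d * (2 * Z.of_nat N)) = RtoC 1.
Proof.
  intros HN. unfold root. rewrite !mult_IZR, <- INR_IZR_INZ.
  assert (0 < INR N) by (apply lt_0_INR; lia).
  replace (PI / INR N * (IZR d * (2 * INR N))) with (2 * IZR d * PI) by (field; lra).
  unfold expi. replace (2 * IZR d * PI) with (2 * (IZR d * PI)) by ring.
  rewrite cos_2a_sin, sin_2a.
  assert (E : sin (IZR d * PI) = 0) by (apply sin_eq_0_1; exists d; reflexivity).
  rewrite E. unfold RtoC. f_equal; ring.
Qed.

Lemma root_eq_1 (N : nat) (d : Z) :
  (0 < N)%nat -> root N d = RtoC 1 -> exists q, (d = q * (2 * Z.of_nat N))%Z.
Proof.
  intros HN H. unfold root, expi, RtoC in H. injection H as Hc _.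
  assert (HN' : 0 < INR N) by (apply lt_0_INR; lia).
  set (x := PI / INR N * IZR d) in *.
  replace x with (2 * (x / 2)) in Hc by field.
  rewrite cos_2a_sin in Hc.
  assert (Hs : sin (x / 2) = 0) by nra.
  apply sin_eq_0_0 in Hs. destruct Hs as [q Hq]. exists q.
  apply eq_IZR. rewrite !mult_IZR, <- INR_IZR_INZ.
  assert (HPI := PI_RGT_0). unfold x in Hq.
  apply (Rmult_eq_reg_l (PI / INR N / 2)).
  - replace (PI / INR N / 2 * IZR d) with (PI / INR N * IZR d / 2) by (field; lra).
    rewrite Hq. field. lra.
  - assert (0 < / INR N) by now apply Rinv_0_lt_compat.
    unfold Rdiv. nra.
Qed.

Lemma zsum_one (M : nat) : zsum M (fun _ => RtoC 1) = RtoC (INR M).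
Proof.
  induction M as [|M IH]; [now rewrite zsum_0|].
  rewrite zsum_S, IH, S_INR, RtoC_plus. reflexivity.
Qed.

(** Multiplying a geometric sum by its ratio shifts it; the formulation without
    division also covers the ratio 1. *)
Lemma geometric_shift (N : nat) (d : Z) (M : nat) :
  (root N d * zsum M (fun i => root N (d * i)) + root N d =
   zsum M (fun i => root N (d * i)) + root N (d * Z.of_nat (S M)))%C.
Proof.
  induction M as [|M IH].
  - rewrite !zsum_0. replace (d * Z.of_nat 1)%Z with d by lia. ring.
  - rewrite !zsum_S.
    replace (d * Z.of_nat (S (S M)))%Z with (d + d * Z.of_nat (S M))%Z by lia.
    rewrite (root_plus N d (d * Z.of_nat (S M))).
    transitivity ((root N d * zsum M (fun i => root N (d * i)) + root N d)
                  + root N d * root N (d * Z.of_nat (S M)))%C; [ring|].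
    rewrite IH. ring.
Qed.

(** For two nodes the difference is smaller than 2N in absolute value, so the ratio
    of the geometric sum is 1 only on the diagonal. *)
Lemma root_orthogonal (N : nat) (i k : Z) :
  (0 < N)%nat -> is_node N i -> is_node N k ->
  zsum (2 * N) (fun n => root N ((i - k) * n)) = (RtoC (2 * INR N) * delta i k)%C.
Proof.
  intros HN Hi Hk. unfold delta. destruct (Z.eq_dec i k) as [->|E].
  - rewrite (zsum_ext _ _ (fun _ => RtoC 1)).
    + rewrite zsum_one, mult_INR. change (INR 2) with 2. ring.
    + intros n _. replace ((k - k) * n)%Z with 0%Z by ring. apply root_0.
  - assert (H := geometric_shift N (i - k) (2 * N)).
    replace ((i - k) * Z.of_nat (S (2 * N)))%Z
      with ((i - k) + (i - k) * (2 * Z.of_nat N))%Z in H by lia.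
    rewrite root_plus, root_period in H by exact HN.
    set (S0 := zsum _ _) in *. set (z := root N (i - k)) in *.
    assert (Hz : (z - 1)%C <> 0).
    { intros Hz. assert (Hz1 : z = RtoC 1).
      { replace z with ((z - 1) + 1)%C by ring. rewrite Hz. ring. }
      apply root_eq_1 in Hz1; [|exact HN]. destruct Hz1 as [q Hq].
      unfold is_node in *. assert (q = 0)%Z by nia. subst q. lia. }
    assert (HS : ((z - 1) * S0 = 0)%C).
    { transitivity ((z * S0 + z) - (S0 + z * 1))%C; [ring|]. rewrite H. ring. }
    transitivity (/ (z - 1) * ((z - 1) * S0))%C; [field; exact Hz|].
    rewrite HS. ring.
Qed.

(** The frequencies are the shifted range -N+1..N; the shift contributes a phase that
    is trivial exactly where the sum does not vanish. *)
Lemma root_orthogonal_freq (N : nat) (i k : Z) :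
  (0 < N)%nat -> is_node N i -> is_node N k ->
  zsum (2 * N) (fun n => root N ((i - k) * (n - Z.of_nat N))) =
  (RtoC (2 * INR N) * delta i k)%C.
Proof.
  intros HN Hi Hk.
  transitivity (root N (- ((i - k) * Z.of_nat N)) *
                zsum (2 * N) (fun n => root N ((i - k) * n)))%C.
  - rewrite <- zsum_mult_l. apply zsum_ext; intros n _.
    rewrite <- root_plus. f_equal. ring.
  - rewrite root_orthogonal by assumption. unfold delta.
    destruct (Z.eq_dec i k) as [->|E]; [|ring].
    replace (- ((k - k) * Z.of_nat N))%Z with 0%Z by ring. rewrite root_0. ring.
Qed.

(** * Fourier multipliers *)

Lemma phase_root (L : R) (N : nat) (k l i j : Z) :
  0 < L -> (0 < N)%nat ->
  expi (phase L N k l i j) = (root N (k * i) * root N (l * j))%C.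
Proof.
  intros HL HN. assert (0 < INR N) by (apply lt_0_INR; lia).
  unfold root. rewrite <- expi_plus. f_equal. unfold phase, node, mesh.
  rewrite !mult_IZR. field. lra.
Qed.

Lemma phase_opp_root (L : R) (N : nat) (k l i j : Z) :
  0 < L -> (0 < N)%nat ->
  expi (- phase L N k l i j) = (root N (- (k * i)) * root N (- (l * j)))%C.
Proof.
  intros HL HN. rewrite <- expi_conj, phase_root, Cmult_conj, !root_opp by assumption.
  reflexivity.
Qed.

(** What makes the operators composable: synthesis followed by analysis is the
    identity on the retained frequencies. *)
Lemma fourier_coef_mult (L : R) (N : nat) (m : Z -> Z -> C) (f : grid_fun) (k l : Z) :
  0 < L -> (0 < N)%nat -> is_node N k -> is_node N l ->
  let n := Z.of_nat N in
  fourier_coef L N (fourier_mult L N m f) (k - n) (l - n) =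
  (m (k - n)%Z (l - n)%Z * fourier_coef L N f (k - n) (l - n))%C.
Proof.
  intros HL HN Hk Hl n. assert (HN' : 0 < INR N) by (apply lt_0_INR; lia).
  set (G := fun p q : Z =>
    (m (p - n)%Z (q - n)%Z * fourier_coef L N f (p - n) (q - n))%C).
  change (fourier_coef L N (fourier_mult L N m f) (k - n) (l - n) = G k l).
  unfold fourier_coef at 1, fourier_mult, freq_sum.
  rewrite (grid_sum_ext N _ (fun i j => grid_sum N (fun p q =>
     G p q * (root N ((p - k) * i) * root N ((q - l) * j)))%C)).
  2:{ intros i j _ _. rewrite <- grid_sum_mult_r. apply grid_sum_ext; intros p q _ _.
      rewrite phase_root, phase_opp_root by assumption. fold n. unfold G.
      replace ((p - k) * i)%Z with ((p - n) * i + - ((k - n) * i))%Z by ring.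
      replace ((q - l) * j)%Z with ((q - n) * j + - ((l - n) * j))%Z by ring.
      rewrite !root_plus. ring. }
  rewrite grid_sum_swap.
  rewrite (grid_sum_ext N _ (fun p q =>
     RtoC (4 * INR N ^ 2) * (G p q * (delta p k * delta q l)))%C).
  2:{ intros p q Hp Hq. rewrite grid_sum_mult_l, grid_sum_prod.
      rewrite !root_orthogonal by assumption.
      replace (4 * INR N ^ 2) with ((2 * INR N) * (2 * INR N)) by ring.
      rewrite (RtoC_mult (2 * INR N) (2 * INR N)). ring. }
  rewrite grid_sum_mult_l, grid_sum_delta by assumption.
  rewrite Cmult_assoc, <- RtoC_mult, Rinv_l by nra. ring.
Qed.

Lemma fourier_mult_comp (L : R) (N : nat) (m1 m2 : Z -> Z -> C) (f : grid_fun) :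
  0 < L -> (0 < N)%nat ->
  fourier_mult L N m1 (fourier_mult L N m2 f) =
  fourier_mult L N (fun k l => m1 k l * m2 k l)%C f.
Proof.
  intros HL HN. extensionality i; extensionality j.
  unfold fourier_mult at 1 3, freq_sum. apply grid_sum_ext; intros k l Hk Hl.
  rewrite fourier_coef_mult by assumption. ring.
Qed.

(** Fourier inversion, at the nodes 1..2N only: they are all that the operators and
    the inner product see. *)
Lemma fourier_mult_one (L : R) (N : nat) (f : grid_fun) (i j : Z) :
  0 < L -> (0 < N)%nat -> is_node N i -> is_node N j ->
  fourier_mult L N (fun _ _ => RtoC 1) f i j = f i j.
Proof.
  intros HL HN Hi Hj. assert (HN' : 0 < INR N) by (apply lt_0_INR; lia).
  set (n := Z.of_nat N).
  unfold fourier_mult, freq_sum, fourier_coef.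
  rewrite (grid_sum_ext N _ (fun k l => grid_sum N (fun p q =>
     RtoC (/ (4 * INR N ^ 2)) *
     (f p q * (root N ((i - p) * (k - n)) * root N ((j - q) * (l - n)))))%C)).
  2:{ intros k l _ _.
      rewrite Cmult_1_l, <- Cmult_assoc, <- grid_sum_mult_r, <- grid_sum_mult_l.
      apply grid_sum_ext; intros p q _ _.
      rewrite phase_root, phase_opp_root by assumption. fold n.
      replace ((i - p) * (k - n))%Z with (- ((k - n) * p) + (k - n) * i)%Z by ring.
      replace ((j - q) * (l - n))%Z with (- ((l - n) * q) + (l - n) * j)%Z by ring.
      rewrite !root_plus. ring. }
  rewrite grid_sum_swap.
  rewrite (grid_sum_ext N _ (fun p q => f p q * (delta p i * delta q j))%C).
  - apply grid_sum_delta; assumption.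
  - intros p q Hp Hq. rewrite !grid_sum_mult_l, grid_sum_prod. unfold n.
    rewrite !root_orthogonal_freq by assumption.
    transitivity (RtoC (/ (4 * INR N ^ 2) * ((2 * INR N) * (2 * INR N))) *
                  (f p q * (delta i p * delta j q)))%C.
    + rewrite !(RtoC_mult _ (2 * INR N * _)), (RtoC_mult (2 * INR N) (2 * INR N)). ring.
    + replace (/ (4 * INR N ^ 2) * (2 * INR N * (2 * INR N))) with 1 by (field; lra).
      unfold delta. destruct (Z.eq_dec i p), (Z.eq_dec p i); try lia;
      destruct (Z.eq_dec j q), (Z.eq_dec q j); try lia; ring.
Qed.

Lemma fourier_mult_ext (L : R) (N : nat) (m : Z -> Z -> C) (f g : grid_fun) :
  (forall i j, is_node N i -> is_node N j -> f i j = g i j) ->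
  fourier_mult L N m f = fourier_mult L N m g.
Proof.
  intros H. extensionality i; extensionality j. unfold fourier_mult, freq_sum.
  apply grid_sum_ext; intros k l _ _. unfold fourier_coef.
  do 3 f_equal. apply grid_sum_ext; intros p q Hp Hq. now rewrite H.
Qed.

Lemma fourier_coef_lin (L : R) (N : nat) (a : R) (f g : grid_fun) (k l : Z) :
  fourier_coef L N (gadd f (gscal a g)) k l =
  (fourier_coef L N f k l + RtoC a * fourier_coef L N g k l)%C.
Proof.
  unfold fourier_coef.
  rewrite (grid_sum_ext N _ (fun i j => f i j * expi (- phase L N k l i j) +
    RtoC a * (g i j * expi (- phase L N k l i j)))%C).
  - rewrite grid_sum_plus, grid_sum_mult_l. ring.
  - intros i j _ _. unfold gadd, gscal. ring.
Qed.

Lemma fourier_mult_lin (L : R) (N : nat) (m : Z -> Z -> C) (a : R) (f g : grid_fun) :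
  fourier_mult L N m (gadd f (gscal a g)) =
  gadd (fourier_mult L N m f) (gscal a (fourier_mult L N m g)).
Proof.
  extensionality i; extensionality j. unfold fourier_mult, freq_sum, gadd at 2, gscal at 2.
  rewrite <- grid_sum_mult_l, <- grid_sum_plus. apply grid_sum_ext; intros k l _ _.
  rewrite fourier_coef_lin. ring.
Qed.

Lemma fourier_mult_add_symbol (L : R) (N : nat) (m1 m2 : Z -> Z -> C) (a : R) (f : grid_fun) :
  gadd (fourier_mult L N m1 f) (gscal a (fourier_mult L N m2 f)) =
  fourier_mult L N (fun k l => m1 k l + RtoC a * m2 k l)%C f.
Proof.
  extensionality i; extensionality j. unfold fourier_mult, freq_sum, gadd, gscal.
  rewrite <- grid_sum_mult_l, <- grid_sum_plus. apply grid_sum_ext; intros k l _ _.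
  ring.
Qed.

Lemma fourier_mult_ext_symbol (L : R) (N : nat) (m1 m2 : Z -> Z -> C) (f : grid_fun) :
  (forall k l, m1 k l = m2 k l) -> fourier_mult L N m1 f = fourier_mult L N m2 f.
Proof.
  intros H. extensionality i; extensionality j. unfold fourier_mult, freq_sum.
  apply grid_sum_ext; intros k l _ _. now rewrite H.
Qed.

(** A Parseval formula, from exchanging the sums over nodes and frequencies. *)
Lemma inner_fourier_mult_l (L : R) (N : nat) (m : Z -> Z -> C) (f g : grid_fun) :
  (0 < N)%nat ->
  inner L N (fourier_mult L N m f) g =
  (RtoC (mesh L N ^ 2 * (4 * INR N ^ 2)) * freq_sum N (fun k l =>
     m k l * (fourier_coef L N f k l * Cconj (fourier_coef L N g k l))))%C.
Proof.
  intros HN. assert (HN' : 0 < INR N) by (apply lt_0_INR; lia).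
  rewrite RtoC_mult, <- Cmult_assoc. unfold inner. f_equal.
  unfold fourier_mult, freq_sum.
  rewrite <- grid_sum_mult_l.
  rewrite (grid_sum_ext N _ (fun i j => grid_sum N (fun k l =>
    m (k - Z.of_nat N)%Z (l - Z.of_nat N)%Z *
    fourier_coef L N f (k - Z.of_nat N) (l - Z.of_nat N) *
    (expi (phase L N (k - Z.of_nat N) (l - Z.of_nat N) i j) * Cconj (g i j)))%C)).
  2:{ intros i j _ _. rewrite <- grid_sum_mult_r. apply grid_sum_ext; intros; ring. }
  rewrite grid_sum_swap. apply grid_sum_ext; intros k l _ _.
  rewrite grid_sum_mult_l. unfold fourier_coef at 3.
  rewrite Cmult_conj, grid_sum_conj.
  replace (Cconj (RtoC (/ (4 * INR N ^ 2)))) with (RtoC (/ (4 * INR N ^ 2)))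
    by (unfold Cconj, RtoC; simpl; f_equal; ring).
  set (S1 := grid_sum N _). set (S2 := grid_sum N _).
  replace S2 with S1.
  - transitivity (RtoC (4 * INR N ^ 2 * / (4 * INR N ^ 2)) *
      (m (k - Z.of_nat N)%Z (l - Z.of_nat N)%Z *
       fourier_coef L N f (k - Z.of_nat N) (l - Z.of_nat N) * S1))%C.
    + rewrite Rinv_r by nra. ring.
    + rewrite !RtoC_mult. ring.
  - apply grid_sum_ext; intros i j _ _.
    rewrite Cmult_conj, expi_conj, Ropp_involutive. ring.
Qed.

Lemma inner_conj (L : R) (N : nat) (f g : grid_fun) :
  Cconj (inner L N f g) = inner L N g f.
Proof.
  unfold inner. rewrite Cmult_conj, grid_sum_conj. f_equal.
  - unfold Cconj, RtoC; simpl; f_equal; ring.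
  - apply grid_sum_ext; intros. rewrite Cmult_conj, Cconj_conj. ring.
Qed.

Lemma inner_fourier_mult_adjoint (L : R) (N : nat) (m : Z -> Z -> C) (f g : grid_fun) :
  (0 < N)%nat ->
  inner L N (fourier_mult L N m f) g =
  inner L N f (fourier_mult L N (fun k l => Cconj (m k l)) g).
Proof.
  intros HN. rewrite <- (inner_conj L N _ f), !inner_fourier_mult_l by exact HN.
  unfold freq_sum. rewrite Cmult_conj, grid_sum_conj. f_equal.
  - unfold Cconj, RtoC; simpl; f_equal; ring.
  - apply grid_sum_ext; intros. rewrite !Cmult_conj, !Cconj_conj. ring.
Qed.

(** * The real inner product *)

Definition ip (L : R) (N : nat) (f g : grid_fun) : R := Re (inner L N f g).

Lemma Re_zsum_nonneg (M : nat) (f : Z -> C) :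
  (forall i, (1 <= i <= Z.of_nat M)%Z -> 0 <= Re (f i)) -> 0 <= Re (zsum M f).
Proof.
  induction M as [|M IH]; intros H.
  - rewrite zsum_0. simpl; lra.
  - rewrite zsum_S, re_plus. apply Rplus_le_le_0_compat.
    + apply IH. intros; apply H; lia.
    + apply H; lia.
Qed.

Lemma Re_grid_sum_nonneg (N : nat) (F : grid_fun) :
  (forall i j, is_node N i -> is_node N j -> 0 <= Re (F i j)) ->
  0 <= Re (grid_sum N F).
Proof.
  intros H. rewrite grid_sum_zsum. apply Re_zsum_nonneg; intros i Hi.
  apply Re_zsum_nonneg; intros j Hj. apply H; unfold is_node; lia.
Qed.

Lemma ip_lin (L : R) (N : nat) (a : R) (f g h : grid_fun) :
  ip L N (gadd f (gscal a g)) h = ip L N f h + a * ip L N g h.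
Proof.
  unfold ip, inner. rewrite <- re_scal_l, <- re_plus. f_equal.
  rewrite Cmult_assoc, (Cmult_comm (RtoC a)), <- Cmult_assoc.
  rewrite <- (grid_sum_mult_l N (RtoC a)), <- Cmult_plus_distr_l, <- grid_sum_plus.
  f_equal. apply grid_sum_ext; intros. unfold gadd, gscal. ring.
Qed.

Lemma ip_sym (L : R) (N : nat) (f g : grid_fun) : ip L N f g = ip L N g f.
Proof. unfold ip. rewrite <- inner_conj. apply re_conj. Qed.

Lemma ip_lin_r (L : R) (N : nat) (a : R) (f g h : grid_fun) :
  ip L N h (gadd f (gscal a g)) = ip L N h f + a * ip L N h g.
Proof. rewrite ip_sym, ip_lin, !(ip_sym L N h). reflexivity. Qed.

Lemma gadd_lin (f g : grid_fun) : gadd f g = gadd f (gscal 1 g).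
Proof. extensionality i; extensionality j. unfold gadd, gscal. ring. Qed.

Lemma gsub_lin (f g : grid_fun) : gsub f g = gadd f (gscal (-1) g).
Proof. extensionality i; extensionality j. unfold gsub, gadd, gscal. ring. Qed.

Lemma gscal_lin (a : R) (f : grid_fun) : gscal a f = gadd f (gscal (a - 1) f).
Proof.
  extensionality i; extensionality j. unfold gadd, gscal.
  rewrite RtoC_minus. ring.
Qed.

Lemma ip_add (L : R) (N : nat) (f g h : grid_fun) :
  ip L N (gadd f g) h = ip L N f h + ip L N g h.
Proof. rewrite gadd_lin, ip_lin. ring. Qed.

Lemma ip_sub (L : R) (N : nat) (f g h : grid_fun) :
  ip L N (gsub f g) h = ip L N f h - ip L N g h.
Proof. rewrite gsub_lin, ip_lin. ring. Qed.

Lemma ip_scal (L : R) (N : nat) (a : R) (f h : grid_fun) :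
  ip L N (gscal a f) h = a * ip L N f h.
Proof. rewrite gscal_lin, ip_lin. ring. Qed.

Lemma Re_mult_conj (z : C) : Re (z * Cconj z)%C = Re z ^ 2 + Im z ^ 2.
Proof. rewrite re_mult, re_conj, im_conj. ring. Qed.

Lemma ip_nonneg (L : R) (N : nat) (f : grid_fun) : 0 <= ip L N f f.
Proof.
  unfold ip, inner. rewrite re_scal_l. apply Rmult_le_pos; [apply pow2_ge_0|].
  apply Re_grid_sum_nonneg; intros. rewrite Re_mult_conj. nra.
Qed.

Lemma gnorm_sq (L : R) (N : nat) (f : grid_fun) : gnorm L N f ^ 2 = ip L N f f.
Proof. unfold gnorm. apply pow2_sqrt, ip_nonneg. Qed.

Lemma ip_ext_l (L : R) (N : nat) (f g h : grid_fun) :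
  (forall i j, is_node N i -> is_node N j -> f i j = g i j) ->
  ip L N f h = ip L N g h.
Proof.
  intros H. unfold ip, inner. do 2 f_equal. apply grid_sum_ext; intros.
  now rewrite H.
Qed.

(** * Spectral differential operators *)

Lemma fourier_mult_scal_symbol (L : R) (N : nat) (m : Z -> Z -> C) (a : R) (f : grid_fun) :
  fourier_mult L N (fun k l => RtoC a * m k l)%C f = gscal a (fourier_mult L N m f).
Proof.
  extensionality i; extensionality j. unfold fourier_mult, freq_sum, gscal.
  rewrite <- grid_sum_mult_l. apply grid_sum_ext; intros; ring.
Qed.

Lemma Cconj_RtoC (a : R) : Cconj (RtoC a) = RtoC a.
Proof. unfold Cconj, RtoC; simpl; f_equal; ring. Qed.

Lemma Cconj_imag (a : R) : Cconj (RtoC a * Ci) = (RtoC (-1) * (RtoC a * Ci))%C.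
Proof. unfold Cconj, RtoC, Ci, Cmult; simpl. f_equal; ring. Qed.

Lemma ip_Dx (L : R) (N : nat) (f g : grid_fun) :
  (0 < N)%nat -> ip L N (Dx L N f) g = - ip L N f (Dx L N g).
Proof.
  intros HN. unfold ip, Dx. rewrite inner_fourier_mult_adjoint by exact HN.
  erewrite fourier_mult_ext_symbol by (intros; apply Cconj_imag).
  rewrite fourier_mult_scal_symbol.
  change (ip L N f (gscal (-1) (Dx L N g)) = - ip L N f (Dx L N g)).
  rewrite ip_sym, ip_scal, (ip_sym L N f). ring.
Qed.

Lemma ip_Dy (L : R) (N : nat) (f g : grid_fun) :
  (0 < N)%nat -> ip L N (Dy L N f) g = - ip L N f (Dy L N g).
Proof.
  intros HN. unfold ip, Dy. rewrite inner_fourier_mult_adjoint by exact HN.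
  erewrite fourier_mult_ext_symbol by (intros; apply Cconj_imag).
  rewrite fourier_mult_scal_symbol.
  change (ip L N f (gscal (-1) (Dy L N g)) = - ip L N f (Dy L N g)).
  rewrite ip_sym, ip_scal, (ip_sym L N f). ring.
Qed.

Definition lap_symbol (L : R) (k l : Z) : R :=
  - (4 * IZR k ^ 2 * PI ^ 2 / L ^ 2) + - (4 * IZR l ^ 2 * PI ^ 2 / L ^ 2).

Lemma laplacian_mult (L : R) (N : nat) (f : grid_fun) :
  laplacian L N f = fourier_mult L N (fun k l => RtoC (lap_symbol L k l)) f.
Proof.
  unfold laplacian, Dx2, Dy2. rewrite gadd_lin, fourier_mult_add_symbol.
  apply fourier_mult_ext_symbol; intros. unfold lap_symbol.
  rewrite (RtoC_plus (- (_ * PI ^ 2 / L ^ 2))). ring.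
Qed.

Lemma bilaplacian_mult (L : R) (N : nat) (f : grid_fun) :
  0 < L -> (0 < N)%nat ->
  bilaplacian L N f = fourier_mult L N (fun k l => RtoC (lap_symbol L k l ^ 2)) f.
Proof.
  intros HL HN. unfold bilaplacian.
  rewrite !laplacian_mult, fourier_mult_comp by assumption.
  apply fourier_mult_ext_symbol; intros.
  rewrite <- RtoC_mult. f_equal. ring.
Qed.

Lemma ip_laplacian (L : R) (N : nat) (f g : grid_fun) :
  (0 < N)%nat -> ip L N (laplacian L N f) g = ip L N f (laplacian L N g).
Proof.
  intros HN. unfold ip. rewrite !laplacian_mult, inner_fourier_mult_adjoint by exact HN.
  f_equal. f_equal. apply fourier_mult_ext_symbol; intros. apply Cconj_RtoC.
Qed.

Lemma Dx_Dx (L : R) (N : nat) (f : grid_fun) :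
  0 < L -> (0 < N)%nat -> Dx L N (Dx L N f) = Dx2 L N f.
Proof.
  intros HL HN. unfold Dx, Dx2. rewrite fourier_mult_comp by assumption.
  apply fourier_mult_ext_symbol; intros. unfold RtoC, Ci, Cmult; simpl.
  f_equal; field; lra.
Qed.

Lemma Dy_Dy (L : R) (N : nat) (f : grid_fun) :
  0 < L -> (0 < N)%nat -> Dy L N (Dy L N f) = Dy2 L N f.
Proof.
  intros HL HN. unfold Dy, Dy2. rewrite fourier_mult_comp by assumption.
  apply fourier_mult_ext_symbol; intros. unfold RtoC, Ci, Cmult; simpl.
  f_equal; field; lra.
Qed.

Definition ip_pair (L : R) (N : nat) (F G : grid_fun * grid_fun) : R :=
  ip L N (fst F) (fst G) + ip L N (snd F) (snd G).

Lemma ip_div (L : R) (N : nat) (F : grid_fun * grid_fun) (g : grid_fun) :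
  (0 < N)%nat -> ip L N (div L N F) g = - ip_pair L N F (grad L N g).
Proof.
  intros HN. unfold div, ip_pair, grad; simpl.
  rewrite ip_add, ip_Dx, ip_Dy by exact HN. ring.
Qed.

Lemma ip_grad (L : R) (N : nat) (f g : grid_fun) :
  0 < L -> (0 < N)%nat ->
  ip_pair L N (grad L N f) (grad L N g) = - ip L N f (laplacian L N g).
Proof.
  intros HL HN. unfold ip_pair, grad; simpl.
  rewrite ip_Dx, ip_Dy by exact HN. rewrite Dx_Dx, Dy_Dy by assumption.
  unfold laplacian. rewrite (ip_sym L N f (gadd _ _)), ip_add, !(ip_sym L N f). ring.
Qed.

Definition resolvent (L : R) (N : nat) (c : R) : grid_fun -> grid_fun :=
  fourier_mult L N (fun k l => RtoC (/ (1 + c * lap_symbol L k l ^ 2))).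

(** Inverts [1 + c Delta^2]: its symbol is at least 1. *)
Lemma resolvent_spec (L : R) (N : nat) (c : R) (f : grid_fun) (i j : Z) :
  0 < L -> (0 < N)%nat -> 0 <= c -> is_node N i -> is_node N j ->
  resolvent L N c (gadd f (gscal c (bilaplacian L N f))) i j = f i j.
Proof.
  intros HL HN Hc Hi Hj. unfold resolvent.
  rewrite fourier_mult_lin, bilaplacian_mult, fourier_mult_comp by assumption.
  rewrite fourier_mult_add_symbol.
  rewrite (fourier_mult_ext_symbol L N _ (fun _ _ => RtoC 1)).
  - now apply fourier_mult_one.
  - intros k l. rewrite <- !RtoC_mult, <- RtoC_plus. f_equal.
    assert (0 <= lap_symbol L k l ^ 2) by apply pow2_ge_0.
    field. nra.
Qed.

(** * The logarithmic potential *)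

(** [P], [Q], [s] stand for [|z|^2], [|z'|^2] and the real inner product of [z] and [z'].
    Bounding [ln x] by [x - 1] leaves a rational inequality that is monotone in [s],
    hence worst for parallel vectors; there the two sides differ by a nonnegative
    multiple of [(|z| - |z'|)^2]. *)
Lemma potential_bound (P Q s : R) :
  0 <= P -> 0 <= Q -> s ^ 2 <= P * Q ->
  - (1 / 2) * ln (1 + Q) - - (1 / 2) * ln (1 + P)
  <= - ((s - P) / (1 + P)) + (P + Q - 2 * s).
Proof.
  intros HP HQ Hs.
  assert (Hln : ln ((1 + P) / (1 + Q)) <= (1 + P) / (1 + Q) - 1).
  { assert (0 < (1 + P) / (1 + Q)) by (apply Rdiv_lt_0_compat; lra).
    assert (H1 := exp_ineq1_le (ln ((1 + P) / (1 + Q)))).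
    rewrite exp_ln in H1 by assumption. lra. }
  rewrite ln_div in Hln by lra.
  rewrite <- (pow2_sqrt P HP), <- (pow2_sqrt Q HQ) in *.
  set (x := sqrt P) in *. set (y := sqrt Q) in *.
  assert (Hx : 0 <= x) by apply sqrt_pos. assert (Hy : 0 <= y) by apply sqrt_pos.
  assert (Hxy : 0 <= x * y) by nra.
  assert (Hs' : s <= x * y) by nra.
  assert (HX : 0 < 1 + x ^ 2) by nra. assert (HY : 0 < 1 + y ^ 2) by nra.
  assert (Hinv : 0 < / (1 + x ^ 2)) by now apply Rinv_0_lt_compat.
  assert (Hmono : (s - x ^ 2) / (1 + x ^ 2) + 2 * s
                  <= (x * y - x ^ 2) / (1 + x ^ 2) + 2 * (x * y)).
  { unfold Rdiv. nra. }
  assert (Hmain : ((1 + x ^ 2) / (1 + y ^ 2) - 1) / 2 + (x * y - x ^ 2) / (1 + x ^ 2)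
                  <= (x - y) ^ 2).
  { apply Rminus_le_0.
    replace (_ - _) with
      ((x - y) ^ 2 * ((2 * (1 + x ^ 2) * (1 + y ^ 2) - (x ^ 2 + 2 * x * y - 1))
         / (2 * (1 + x ^ 2) * (1 + y ^ 2)))) by (field; lra).
    apply Rmult_le_pos; [apply pow2_ge_0|]. apply Rle_mult_inv_pos; [|nra].
    assert (0 <= (x - y) ^ 2) by apply pow2_ge_0.
    assert (0 <= x ^ 2 * y ^ 2) by nra. nra. }
  lra.
Qed.

(** With [P], [Q], [s] as above.  The claim is linear in [s] and worst at
    [2 s = P + Q]; there it holds because [P/(1+P)] increases with [P] while [1/(1+P)]
    decreases. *)
Lemma flux_lipschitz_scalar (P Q s : R) :
  0 <= P -> 0 <= Q -> 2 * s <= P + Q ->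
  P / (1 + P) ^ 2 + Q / (1 + Q) ^ 2 - 2 * s / ((1 + P) * (1 + Q)) <= P + Q - 2 * s.
Proof.
  intros HP HQ Hs.
  set (a := / (1 + P)). set (b := / (1 + Q)).
  assert (Ha : 0 < a) by (apply Rinv_0_lt_compat; lra).
  assert (Hb : 0 < b) by (apply Rinv_0_lt_compat; lra).
  assert (EP : P * a = 1 - a) by (unfold a; field; lra).
  assert (EQ : Q * b = 1 - b) by (unfold b; field; lra).
  assert (Ha1 : a <= 1) by nra. assert (Hb1 : b <= 1) by nra.
  replace (P / (1 + P) ^ 2) with ((P * a) * a) by (unfold a; field; lra).
  replace (Q / (1 + Q) ^ 2) with ((Q * b) * b) by (unfold b; field; lra).
  replace (2 * s / ((1 + P) * (1 + Q))) with (2 * s * (a * b))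
    by (unfold a, b; field; lra).
  assert (Hab : 0 <= 1 - a * b) by nra.
  assert (2 * s * (1 - a * b) <= (P + Q) * (1 - a * b)) by nra.
  assert (P * a * a + Q * b * b <= (P + Q) * (a * b)).
  { replace ((P + Q) * (a * b)) with ((P * a) * b + (Q * b) * a) by ring.
    rewrite EP, EQ. assert (0 <= (a - b) ^ 2) by apply pow2_ge_0. lra. }
  nra.
Qed.

Lemma vmod_sq (F : grid_fun * grid_fun) (i j : Z) :
  vmod F i j ^ 2 = Re (fst F i j) ^ 2 + Im (fst F i j) ^ 2
                   + (Re (snd F i j) ^ 2 + Im (snd F i j) ^ 2).
Proof.
  assert (HC : forall z : C, Cmod z ^ 2 = Re z ^ 2 + Im z ^ 2).
  { intros z. unfold Cmod, Re, Im. rewrite pow2_sqrt; [reflexivity|nra]. }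
  unfold vmod. rewrite pow2_sqrt, !HC; [reflexivity|].
  apply Rplus_le_le_0_compat; apply pow2_ge_0.
Qed.

Lemma Re_div_RtoC (z : C) (w : R) : w <> 0 -> Re (z / RtoC w)%C = Re z / w.
Proof. intros H. unfold Cdiv. rewrite <- RtoC_inv by exact H. apply re_scal_r. Qed.

Lemma Im_div_RtoC (z : C) (w : R) : w <> 0 -> Im (z / RtoC w)%C = Im z / w.
Proof. intros H. unfold Cdiv. rewrite <- RtoC_inv by exact H. apply im_scal_r. Qed.

(** [fN] is the divergence of this field, z / (1 + |z|^2) at z = grad v. *)
Definition flux (L : R) (N : nat) (v : grid_fun) : grid_fun * grid_fun :=
  let G := grad L N v in
  (fun i j => (fst G i j / RtoC (1 + vmod G i j ^ 2))%C,
   fun i j => (snd G i j / RtoC (1 + vmod G i j ^ 2))%C).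

Lemma fN_flux (L : R) (N : nat) (v : grid_fun) : fN L N v = div L N (flux L N v).
Proof. reflexivity. Qed.

Definition gsub_pair (F G : grid_fun * grid_fun) : grid_fun * grid_fun :=
  (gsub (fst F) (fst G), gsub (snd F) (snd G)).

Lemma Dx_sub (L : R) (N : nat) (f g : grid_fun) :
  Dx L N (gsub f g) = gsub (Dx L N f) (Dx L N g).
Proof. rewrite !gsub_lin. apply fourier_mult_lin. Qed.

Lemma Dy_sub (L : R) (N : nat) (f g : grid_fun) :
  Dy L N (gsub f g) = gsub (Dy L N f) (Dy L N g).
Proof. rewrite !gsub_lin. apply fourier_mult_lin. Qed.

Lemma grad_sub (L : R) (N : nat) (f g : grid_fun) :
  grad L N (gsub f g) = gsub_pair (grad L N f) (grad L N g).
Proof. unfold grad, gsub_pair; simpl. now rewrite Dx_sub, Dy_sub. Qed.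

Lemma ip_sum (L : R) (N : nat) (f g : grid_fun) :
  ip L N f g = mesh L N ^ 2 * Re (grid_sum N (fun i j => f i j * Cconj (g i j))%C).
Proof. unfold ip, inner. apply re_scal_l. Qed.

Lemma Re_grid_sum_plus (N : nat) (F G : grid_fun) :
  Re (grid_sum N F) + Re (grid_sum N G) = Re (grid_sum N (fun i j => F i j + G i j)%C).
Proof. now rewrite grid_sum_plus, re_plus. Qed.

Lemma Re_grid_sum_opp (N : nat) (F : grid_fun) :
  - Re (grid_sum N F) = Re (grid_sum N (fun i j => RtoC (-1) * F i j)%C).
Proof. rewrite grid_sum_mult_l, re_scal_l. ring. Qed.

Lemma flux_lipschitz (L : R) (N : nat) (p q : grid_fun) :
  let F := gsub_pair (flux L N p) (flux L N q) in
  let G := grad L N (gsub p q) in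
  ip_pair L N F F <= ip_pair L N G G.
Proof.
  intros F G. unfold G. rewrite grad_sub. unfold ip_pair, F.
  rewrite !ip_sum. apply Rminus_le_0.
  match goal with |- 0 <= ?c * ?a + ?c * ?b - (?c * ?d + ?c * ?e) =>
    replace (c * a + c * b - (c * d + c * e)) with (c * ((a + b) + - (d + e))) by ring
  end.
  apply Rmult_le_pos; [apply pow2_ge_0|].
  rewrite !Re_grid_sum_plus, Re_grid_sum_opp, Re_grid_sum_plus.
  apply Re_grid_sum_nonneg; intros i j _ _.
  rewrite re_plus, re_scal_l, !re_plus, !Re_mult_conj.
  unfold gsub_pair, flux, gsub; cbn [fst snd].
  change (fst (grad L N p)) with (Dx L N p). change (snd (grad L N p)) with (Dy L N p).
  change (fst (grad L N q)) with (Dx L N q). change (snd (grad L N q)) with (Dy L N q).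
  unfold Cminus. rewrite !re_plus, !im_plus, !re_opp, !im_opp.
  assert (Hp := vmod_sq (grad L N p) i j). assert (Hq := vmod_sq (grad L N q) i j).
  change (fst (grad L N p)) with (Dx L N p) in Hp.
  change (snd (grad L N p)) with (Dy L N p) in Hp.
  change (fst (grad L N q)) with (Dx L N q) in Hq.
  change (snd (grad L N q)) with (Dy L N q) in Hq.
  set (P := vmod (grad L N p) i j ^ 2) in *. set (Q := vmod (grad L N q) i j ^ 2) in *.
  assert (HP : 0 <= P) by apply pow2_ge_0. assert (HQ : 0 <= Q) by apply pow2_ge_0.
  rewrite !Re_div_RtoC, !Im_div_RtoC by lra.
  set (a := Re (Dx L N p i j)) in *. set (b := Im (Dx L N p i j)) in *.
  set (c := Re (Dy L N p i j)) in *. set (d := Im (Dy L N p i j)) in *.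
  set (a' := Re (Dx L N q i j)) in *. set (b' := Im (Dx L N q i j)) in *.
  set (c' := Re (Dy L N q i j)) in *. set (d' := Im (Dy L N q i j)) in *.
  set (s := a * a' + b * b' + c * c' + d * d').
  assert (Hs : 2 * s <= P + Q).
  { rewrite Hp, Hq. unfold s.
    assert (0 <= (a - a') ^ 2) by apply pow2_ge_0.
    assert (0 <= (b - b') ^ 2) by apply pow2_ge_0.
    assert (0 <= (c - c') ^ 2) by apply pow2_ge_0.
    assert (0 <= (d - d') ^ 2) by apply pow2_ge_0. nra. }
  assert (H := flux_lipschitz_scalar P Q s HP HQ Hs).
  match goal with |- 0 <= ?X + -1 * ?Y =>
    replace X with (P + Q - 2 * s) by (rewrite Hp, Hq; unfold s; ring);
    replace Y with (P / (1 + P) ^ 2 + Q / (1 + Q) ^ 2 - 2 * s / ((1 + P) * (1 + Q)))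
  end; [lra|].
  transitivity ((a ^ 2 + b ^ 2 + (c ^ 2 + d ^ 2)) / (1 + P) ^ 2
     + (a' ^ 2 + b' ^ 2 + (c' ^ 2 + d' ^ 2)) / (1 + Q) ^ 2
     - 2 * s / ((1 + P) * (1 + Q))); [now rewrite <- Hp, <- Hq|].
  clear - HP HQ. unfold s. field; lra.
Qed.

Definition potential (L : R) (N : nat) (v : grid_fun) : R :=
  ip L N (fun i j => RtoC (- (1 / 2) * ln (1 + vmod (grad L N v) i j ^ 2))) gone.

Lemma energy_split (L eps : R) (N : nat) (v : grid_fun) :
  energy L eps N v =
  potential L N v + eps ^ 2 / 2 * ip L N (laplacian L N v) (laplacian L N v).
Proof. unfold energy. now rewrite gnorm_sq. Qed.

(** The potential is not concave in the gradient, so a quadratic remainder is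
    unavoidable; its constant 1 is what the dissipation can absorb. *)
Lemma potential_increment (L : R) (N : nat) (p q : grid_fun) :
  (0 < N)%nat ->
  let G := grad L N (gsub q p) in
  potential L N q - potential L N p <= ip L N (fN L N p) (gsub q p) + ip_pair L N G G.
Proof.
  intros HN G. rewrite fN_flux, ip_div by exact HN. unfold G. rewrite grad_sub.
  unfold ip_pair, potential. rewrite !ip_sum. apply Rminus_le_0.
  match goal with |- 0 <= - (?k * ?a + ?k * ?b) + (?k * ?c + ?k * ?d) - (?k * ?e - ?k * ?f) =>
    replace (- (k * a + k * b) + (k * c + k * d) - (k * e - k * f))
    with (k * (((- (a + b)) + (c + d)) + (f + - e))) by ring
  end.
  apply Rmult_le_pos; [apply pow2_ge_0|].
  rewrite !Re_grid_sum_plus, !Re_grid_sum_opp, !Re_grid_sum_plus.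
  apply Re_grid_sum_nonneg; intros i j _ _.
  rewrite !re_plus, !re_scal_l, !re_plus, !Re_mult_conj.
  unfold gsub_pair, flux, gsub, gone; cbn [fst snd].
  change (fst (grad L N p)) with (Dx L N p). change (snd (grad L N p)) with (Dy L N p).
  change (fst (grad L N q)) with (Dx L N q). change (snd (grad L N q)) with (Dy L N q).
  unfold Cminus. rewrite !re_mult, !re_conj, !im_conj.
  rewrite !re_plus, !im_plus, !re_opp, !im_opp, !re_RtoC.
  assert (Hp := vmod_sq (grad L N p) i j). assert (Hq := vmod_sq (grad L N q) i j).
  change (fst (grad L N p)) with (Dx L N p) in Hp.
  change (snd (grad L N p)) with (Dy L N p) in Hp.
  change (fst (grad L N q)) with (Dx L N q) in Hq.
  change (snd (grad L N q)) with (Dy L N q) in Hq.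
  set (P := vmod (grad L N p) i j ^ 2) in *. set (Q := vmod (grad L N q) i j ^ 2) in *.
  assert (HP : 0 <= P) by apply pow2_ge_0. assert (HQ : 0 <= Q) by apply pow2_ge_0.
  rewrite !Re_div_RtoC, !Im_div_RtoC by lra.
  set (a := Re (Dx L N p i j)) in *. set (b := Im (Dx L N p i j)) in *.
  set (c := Re (Dy L N p i j)) in *. set (d := Im (Dy L N p i j)) in *.
  set (a' := Re (Dx L N q i j)) in *. set (b' := Im (Dx L N q i j)) in *.
  set (c' := Re (Dy L N q i j)) in *. set (d' := Im (Dy L N q i j)) in *.
  set (s := a * a' + b * b' + c * c' + d * d').
  assert (Hs : s ^ 2 <= P * Q).
  { rewrite Hp, Hq. unfold s. apply Rminus_le_0.
    match goal with |- 0 <= ?X => replace X with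
      ((a * b' - b * a') ^ 2 + (a * c' - c * a') ^ 2 + (a * d' - d * a') ^ 2
       + (b * c' - c * b') ^ 2 + (b * d' - d * b') ^ 2 + (c * d' - d * c') ^ 2) by ring end.
    repeat apply Rplus_le_le_0_compat; apply pow2_ge_0. }
  assert (H := potential_bound P Q s HP HQ Hs).
  match goal with |- 0 <= ?X =>
    replace X with (- ((s - (a ^ 2 + b ^ 2 + (c ^ 2 + d ^ 2))) / (1 + P))
      + ((a ^ 2 + b ^ 2 + (c ^ 2 + d ^ 2)) + (a' ^ 2 + b' ^ 2 + (c' ^ 2 + d' ^ 2)) - 2 * s)
      + (- (1 / 2) * ln (1 + P) - - (1 / 2) * ln (1 + Q)))
  end.
  - rewrite <- Hp, <- Hq. lra.
  - clear - HP. unfold s. field. lra.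
Qed.

(** Expand [|f + r tau Delta f|^2 >= 0] with [r = (3 + sqrt 3)/6] and use
    [(f, Delta f) = - |grad f|^2]. *)
Lemma grad_interpolation (L : R) (N : nat) (tau : R) (f : grid_fun) :
  0 < L -> (0 < N)%nat ->
  let G := grad L N f in
  tau * ip_pair L N G G <=
  (3 - sqrt 3) / 2 * ip L N f f
  + (3 + sqrt 3) / 12 * tau ^ 2 * ip L N (laplacian L N f) (laplacian L N f).
Proof.
  intros HL HN G. unfold G. rewrite ip_grad by assumption.
  set (r := (3 + sqrt 3) / 6).
  assert (H := ip_nonneg L N (gadd f (gscal (r * tau) (laplacian L N f)))).
  rewrite !ip_lin, !ip_lin_r, (ip_sym L N (laplacian L N f) f) in H.
  set (x := ip L N f f) in *. set (y := ip L N f (laplacian L N f)) in *.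
  set (z := ip L N (laplacian L N f) (laplacian L N f)) in *.
  assert (H3 : sqrt 3 ^ 2 = 3) by (apply pow2_sqrt; lra).
  assert (Hs : 0 < 3 - sqrt 3).
  { destruct (Rlt_le_dec (sqrt 3) 3) as [Hlt|Hge]; [lra|]. clear - H3 Hge. nra. }
  (* the weight [(3 - sqrt 3) / 2] is [1 / (2 r)] *)
  assert (H' : 0 <= (3 - sqrt 3) / 2 * (x + r * tau * y + r * tau * (y + r * tau * z))).
  { apply Rmult_le_pos; lra. }
  replace ((3 - sqrt 3) / 2 * (x + r * tau * y + r * tau * (y + r * tau * z))) with
    ((3 - sqrt 3) / 2 * x + (9 - sqrt 3 ^ 2) / 6 * tau * y
     + (9 - sqrt 3 ^ 2) * (3 + sqrt 3) / 72 * tau ^ 2 * z) in H'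
    by (unfold r; field).
  rewrite H3 in H'. lra.
Qed.

(** * Calculus of complex-valued functions of time *)

(** Derivatives are taken for the real and imaginary parts separately, which is
    also how [time_deriv] is built. *)
Definition cderive (f : R -> C) (t : R) (d : C) : Prop :=
  is_derive (fun s => Re (f s)) t (Re d) /\ is_derive (fun s => Im (f s)) t (Im d).

Definition ccont (f : R -> C) (t : R) : Prop :=
  continuous (fun s => Re (f s)) t /\ continuous (fun s => Im (f s)) t.

Lemma cderive_ext (f g : R -> C) (t : R) (d : C) :
  (forall s, f s = g s) -> cderive f t d -> cderive g t d.
Proof.
  intros E [H1 H2]; split;
  [apply (is_derive_ext (fun s => Re (f s)))|apply (is_derive_ext (fun s => Im (f s)))];
  try assumption; intros s; now rewrite E.
Qed.

Lemma ccont_ext (f g : R -> C) (t : R) :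
  (forall s, f s = g s) -> ccont f t -> ccont g t.
Proof.
  intros E [H1 H2]; split;
  [apply (continuous_ext (fun s => Re (f s)))|apply (continuous_ext (fun s => Im (f s)))];
  try assumption; intros s; now rewrite E.
Qed.

Lemma cderive_const (c : C) (t : R) : cderive (fun _ => c) t (RtoC 0).
Proof. split; apply @is_derive_const. Qed.

Lemma ccont_const (c : C) (t : R) : ccont (fun _ => c) t.
Proof. split; apply continuous_const. Qed.

Lemma cderive_plus (f g : R -> C) (t : R) (df dg : C) :
  cderive f t df -> cderive g t dg -> cderive (fun s => f s + g s)%C t (df + dg)%C.
Proof.
  intros [F1 F2] [G1 G2]; split;
  [exact (is_derive_plus _ _ _ _ _ F1 G1)|exact (is_derive_plus _ _ _ _ _ F2 G2)].
Qed.

Lemma ccont_plus (f g : R -> C) (t : R) :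
  ccont f t -> ccont g t -> ccont (fun s => f s + g s)%C t.
Proof.
  intros [F1 F2] [G1 G2]; split;
  [exact (continuous_plus _ _ _ F1 G1)|exact (continuous_plus _ _ _ F2 G2)].
Qed.

Lemma cderive_mult (f g : R -> C) (t : R) (df dg : C) :
  cderive f t df -> cderive g t dg ->
  cderive (fun s => f s * g s)%C t (df * g t + f t * dg)%C.
Proof.
  intros [F1 F2] [G1 G2].
  assert (Hm : forall (a b : R -> R) (da db : R), is_derive a t da -> is_derive b t db ->
            is_derive (fun s => a s * b s) t (da * b t + a t * db)).
  { intros a b da db Ha Hb. apply (is_derive_mult a b t da db Ha Hb).
    intros; apply Rmult_comm. }
  split.
  - assert (H := is_derive_minus _ _ _ _ _ (Hm _ _ _ _ F1 G1) (Hm _ _ _ _ F2 G2)).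
    eapply is_derive_ext; [intros s; symmetry; apply re_mult|].
    replace (Re (df * g t + f t * dg)) with
      (minus (Re df * Re (g t) + Re (f t) * Re dg) (Im df * Im (g t) + Im (f t) * Im dg));
    [exact H|]. rewrite re_plus, !re_mult. unfold minus, plus, opp; simpl. ring.
  - assert (H := is_derive_plus _ _ _ _ _ (Hm _ _ _ _ F1 G2) (Hm _ _ _ _ F2 G1)).
    eapply is_derive_ext; [intros s; symmetry; apply im_mult|].
    replace (Im (df * g t + f t * dg)) with
      (plus (Re df * Im (g t) + Re (f t) * Im dg) (Im df * Re (g t) + Im (f t) * Re dg));
    [exact H|]. rewrite im_plus, !im_mult. unfold plus; simpl. ring.
Qed.

Lemma ccont_mult (f g : R -> C) (t : R) :
  ccont f t -> ccont g t -> ccont (fun s => f s * g s)%C t.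
Proof.
  intros [F1 F2] [G1 G2]; split.
  - eapply continuous_ext; [intros s; symmetry; apply re_mult|].
    apply (continuous_minus (fun s => Re (f s) * Re (g s)) (fun s => Im (f s) * Im (g s)));
    [exact (continuous_mult _ _ _ F1 G1)|exact (continuous_mult _ _ _ F2 G2)].
  - eapply continuous_ext; [intros s; symmetry; apply im_mult|].
    apply (continuous_plus (fun s => Re (f s) * Im (g s)) (fun s => Im (f s) * Re (g s)));
    [exact (continuous_mult _ _ _ F1 G2)|exact (continuous_mult _ _ _ F2 G1)].
Qed.

Lemma cderive_scal (c : C) (f : R -> C) (t : R) (d : C) :
  cderive f t d -> cderive (fun s => c * f s)%C t (c * d)%C.
Proof.
  intros H. replace (c * d)%C with (RtoC 0 * f t + c * d)%C by ring.
  apply cderive_mult; [apply cderive_const|exact H].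
Qed.

Lemma cderive_scal_r (c : C) (f : R -> C) (t : R) (d : C) :
  cderive f t d -> cderive (fun s => f s * c)%C t (d * c)%C.
Proof.
  intros H. replace (d * c)%C with (d * c + f t * RtoC 0)%C by ring.
  apply (cderive_mult f (fun _ => c)); [exact H|apply cderive_const].
Qed.

Lemma cderive_conj (f : R -> C) (t : R) (d : C) :
  cderive f t d -> cderive (fun s => Cconj (f s)) t (Cconj d).
Proof. intros [H1 H2]; split; [exact H1|exact (is_derive_opp _ _ _ H2)]. Qed.

Lemma ccont_conj (f : R -> C) (t : R) : ccont f t -> ccont (fun s => Cconj (f s)) t.
Proof. intros [H1 H2]; split; [exact H1|exact (continuous_opp _ _ H2)]. Qed.

Lemma cderive_unique (f : R -> C) (t : R) (d e : C) :
  cderive f t d -> cderive f t e -> d = e.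
Proof.
  intros [D1 D2] [E1 E2]. apply injective_projections.
  - change (Re d = Re e). now rewrite <- (is_derive_unique _ _ _ D1), (is_derive_unique _ _ _ E1).
  - change (Im d = Im e). now rewrite <- (is_derive_unique _ _ _ D2), (is_derive_unique _ _ _ E2).
Qed.

Lemma cderive_zsum (M : nat) (f : R -> Z -> C) (d : Z -> C) (t : R) :
  (forall i, (1 <= i <= Z.of_nat M)%Z -> cderive (fun s => f s i) t (d i)) ->
  cderive (fun s => zsum M (f s)) t (zsum M d).
Proof.
  induction M as [|M IH]; intros H.
  - rewrite zsum_0. eapply cderive_ext; [|apply (cderive_const 0)].
    intros s; symmetry; apply zsum_0.
  - rewrite zsum_S. eapply cderive_ext; [intros s; symmetry; apply zsum_S|].
    apply cderive_plus; [apply IH; intros|]; apply H; lia.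
Qed.

Lemma ccont_zsum (M : nat) (f : R -> Z -> C) (t : R) :
  (forall i, (1 <= i <= Z.of_nat M)%Z -> ccont (fun s => f s i) t) ->
  ccont (fun s => zsum M (f s)) t.
Proof.
  induction M as [|M IH]; intros H.
  - eapply ccont_ext; [|apply (ccont_const 0)]. intros s; symmetry; apply zsum_0.
  - eapply ccont_ext; [intros s; symmetry; apply zsum_S|].
    apply ccont_plus; [apply IH; intros|]; apply H; lia.
Qed.

Definition path_deriv (N : nat) (w : R -> grid_fun) (t : R) (dw : grid_fun) : Prop :=
  forall i j, is_node N i -> is_node N j -> cderive (fun s => w s i j) t (dw i j).

Definition path_cont (N : nat) (w : R -> grid_fun) (t : R) : Prop :=
  forall i j, is_node N i -> is_node N j -> ccont (fun s => w s i j) t.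

Lemma cderive_grid_sum (N : nat) (w : R -> grid_fun) (dw : grid_fun) (t : R) :
  path_deriv N w t dw -> cderive (fun s => grid_sum N (w s)) t (grid_sum N dw).
Proof.
  intros H.
  apply (cderive_zsum (2 * N) (fun s i => zsum (2 * N) (fun j => w s i j))
           (fun i => zsum (2 * N) (fun j => dw i j))); intros i Hi.
  apply (cderive_zsum (2 * N) (fun s j => w s i j) (fun j => dw i j)); intros j Hj.
  apply H; unfold is_node; lia.
Qed.

Lemma ccont_grid_sum (N : nat) (w : R -> grid_fun) (t : R) :
  path_cont N w t -> ccont (fun s => grid_sum N (w s)) t.
Proof.
  intros H.
  apply (ccont_zsum (2 * N) (fun s i => zsum (2 * N) (fun j => w s i j))); intros i Hi.
  apply (ccont_zsum (2 * N) (fun s j => w s i j)); intros j Hj.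
  apply H; unfold is_node; lia.
Qed.

Lemma cderive_fourier_mult (L : R) (N : nat) (m : Z -> Z -> C) (w : R -> grid_fun)
    (dw : grid_fun) (t : R) (i j : Z) :
  path_deriv N w t dw ->
  cderive (fun s => fourier_mult L N m (w s) i j) t (fourier_mult L N m dw i j).
Proof.
  intros H. unfold fourier_mult, freq_sum.
  apply (cderive_grid_sum N (fun s k l =>
    (m (k - Z.of_nat N)%Z (l - Z.of_nat N)%Z *
     fourier_coef L N (w s) (k - Z.of_nat N) (l - Z.of_nat N) *
     expi (phase L N (k - Z.of_nat N) (l - Z.of_nat N) i j))%C)).
  intros k l _ _.
  apply cderive_scal_r, cderive_scal. unfold fourier_coef. apply cderive_scal.
  apply (cderive_grid_sum N (fun s p q =>
    (w s p q * expi (- phase L N (k - Z.of_nat N) (l - Z.of_nat N) p q))%C)).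
  intros p q Hp Hq. apply cderive_scal_r. now apply H.
Qed.

Lemma ccont_fourier_mult (L : R) (N : nat) (m : Z -> Z -> C) (w : R -> grid_fun)
    (t : R) (i j : Z) :
  path_cont N w t -> ccont (fun s => fourier_mult L N m (w s) i j) t.
Proof.
  intros H. unfold fourier_mult, freq_sum.
  apply (ccont_grid_sum N (fun s k l =>
    (m (k - Z.of_nat N)%Z (l - Z.of_nat N)%Z *
     fourier_coef L N (w s) (k - Z.of_nat N) (l - Z.of_nat N) *
     expi (phase L N (k - Z.of_nat N) (l - Z.of_nat N) i j))%C)).
  intros k l _ _. unfold fourier_coef.
  apply ccont_mult; [|apply ccont_const]. apply ccont_mult; [apply ccont_const|].
  apply ccont_mult; [apply ccont_const|].
  apply (ccont_grid_sum N (fun s p q =>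
    (w s p q * expi (- phase L N (k - Z.of_nat N) (l - Z.of_nat N) p q))%C)).
  intros p q Hp Hq. apply ccont_mult; [now apply H|apply ccont_const].
Qed.

Lemma path_cont_fourier_mult (L : R) (N : nat) (m : Z -> Z -> C) (w : R -> grid_fun) (t : R) :
  path_cont N w t -> path_cont N (fun s => fourier_mult L N m (w s)) t.
Proof. intros H i j _ _. now apply ccont_fourier_mult. Qed.

Lemma path_deriv_laplacian (L : R) (N : nat) (w : R -> grid_fun) (dw : grid_fun) (t : R) :
  path_deriv N w t dw ->
  path_deriv N (fun s => laplacian L N (w s)) t (laplacian L N dw).
Proof.
  intros H i j _ _. rewrite laplacian_mult.
  eapply cderive_ext; [intros s; now rewrite laplacian_mult|].
  now apply cderive_fourier_mult.
Qed.

Lemma path_cont_laplacian (L : R) (N : nat) (w : R -> grid_fun) (t : R) :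
  path_cont N w t -> path_cont N (fun s => laplacian L N (w s)) t.
Proof.
  intros H i j _ _. eapply ccont_ext; [intros s; now rewrite laplacian_mult|].
  now apply ccont_fourier_mult.
Qed.

Lemma path_deriv_const (N : nat) (f : grid_fun) (t : R) :
  path_deriv N (fun _ => f) t (fun _ _ => RtoC 0).
Proof. intros i j _ _. apply cderive_const. Qed.

Lemma path_cont_const (N : nat) (f : grid_fun) (t : R) : path_cont N (fun _ => f) t.
Proof. intros i j _ _. apply ccont_const. Qed.

Lemma is_derive_ip (L : R) (N : nat) (f g : R -> grid_fun) (df dg : grid_fun) (t : R) :
  path_deriv N f t df -> path_deriv N g t dg ->
  is_derive (fun s => ip L N (f s) (g s)) t (ip L N df (g t) + ip L N (f t) dg).
Proof.
  intros Hf Hg.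
  assert (H : path_deriv N (fun s i j => f s i j * Cconj (g s i j))%C t
                (fun i j => df i j * Cconj (g t i j) + f t i j * Cconj (dg i j))%C).
  { intros i j Hi Hj.
    apply (cderive_mult (fun s => f s i j) (fun s => Cconj (g s i j))).
    - now apply Hf.
    - apply (cderive_conj (fun s => g s i j)). now apply Hg. }
  apply cderive_grid_sum in H.
  apply (cderive_scal (RtoC (mesh L N ^ 2))) in H. destruct H as [H _].
  rewrite grid_sum_plus, Cmult_plus_distr_l, re_plus in H. exact H.
Qed.

Lemma continuous_ip (L : R) (N : nat) (f g : R -> grid_fun) (t : R) :
  path_cont N f t -> path_cont N g t ->
  continuous (fun s => ip L N (f s) (g s)) t.
Proof.
  intros Hf Hg. unfold ip, inner.
  apply (ccont_mult (fun _ => RtoC (mesh L N ^ 2))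
    (fun s => grid_sum N (fun i j => f s i j * Cconj (g s i j))%C)); [apply ccont_const|].
  apply (ccont_grid_sum N (fun s i j => f s i j * Cconj (g s i j))%C).
  intros i j Hi Hj. apply ccont_mult; [now apply Hf|].
  apply (ccont_conj (fun s => g s i j)). now apply Hg.
Qed.

Lemma is_derive_ip_const (L : R) (N : nat) (f : grid_fun) (g : R -> grid_fun)
    (dg : grid_fun) (t : R) :
  path_deriv N g t dg ->
  is_derive (fun s => ip L N f (g s)) t (ip L N f dg).
Proof.
  intros H.
  assert (E := is_derive_ip L N _ g _ dg t (path_deriv_const N f t) H).
  replace (ip L N f dg) with (ip L N (fun _ _ => RtoC 0) (g t) + ip L N f dg);
  [exact E|].
  assert (Z : ip L N (fun _ _ => RtoC 0) (g t) = 0).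
  { transitivity (ip L N (gsub (g t) (g t)) (g t)).
    - apply ip_ext_l. intros. unfold gsub. ring.
    - rewrite ip_sub. ring. }
  lra.
Qed.

(** * Derivatives along the paths of the scheme *)

Lemma is_time_deriv_interior (b : R) (w : R -> grid_fun) (t : R) (dw : grid_fun) (i j : Z) :
  0 < t < b -> is_time_deriv b w t dw -> cderive (fun s => w s i j) t (dw i j).
Proof.
  intros Ht H.
  assert (Hin : locally t (fun s => 0 <= s <= b)).
  { apply (locally_interval _ t 0 b); simpl; try lra. intros; lra. }
  assert (Hf : filterdiff (U := R_NormedModule) (V := C_R_NormedModule)
                 (fun s => w s i j) (locally t) (fun y => scal y (dw i j))).
  { destruct (H i j) as [Hl Hd]. split; [exact Hl|]. intros x Hx eps.
    apply (is_filter_lim_locally_unique (V := R_NormedModule) t x) in Hx. subst x.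
    assert (Hlim : is_filter_lim (within (fun s => 0 <= s <= b) (locally t)) t).
    { intros P HP. unfold within. revert HP. apply filter_imp; auto. }
    specialize (Hd t Hlim eps). unfold within in Hd.
    generalize (filter_and _ _ Hin Hd). apply filter_imp.
    intros s [H1 H2]. now apply H2. }
  split.
  - apply (filterdiff_comp (fun s => w s i j) (fun z : C_R_NormedModule => fst z)
             _ (fun z : C_R_NormedModule => fst z)) in Hf.
    + exact Hf.
    + apply filterdiff_linear. exact (is_linear_fst (U := R_NormedModule) (V := R_NormedModule)).
  - apply (filterdiff_comp (fun s => w s i j) (fun z : C_R_NormedModule => snd z)
             _ (fun z : C_R_NormedModule => snd z)) in Hf.
    + exact Hf.
    + apply filterdiff_linear. exact (is_linear_snd (U := R_NormedModule) (V := R_NormedModule)).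
Qed.

Lemma time_deriv_eq (w : R -> grid_fun) (t : R) (i j : Z) (d : C) :
  cderive (fun s => w s i j) t d -> time_deriv w t i j = d.
Proof.
  intros [H1 H2]. apply injective_projections;
  [exact (is_derive_unique _ _ _ H1)|exact (is_derive_unique _ _ _ H2)].
Qed.

(** The paths of the scheme are known only on a time interval [[0, b]] and their
    continuity at the end points is one-sided.  Precomposing with [clamp] yields
    paths that are continuous on the whole line and agree on [[a, b]]. *)
Definition clamp (a b t : R) : R := Rmax a (Rmin b t).

Lemma clamp_id (a b t : R) : a <= t <= b -> clamp a b t = t.
Proof. intros H. unfold clamp. rewrite Rmin_right, Rmax_right; lra. Qed.

Lemma clamp_in (a b t : R) : a <= b -> a <= clamp a b t <= b.
Proof.
  intros H. unfold clamp. split; [apply Rmax_l|].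
  apply Rmax_lub; [lra|apply Rmin_l].
Qed.

Lemma clamp_contract (a b s t : R) : Rabs (clamp a b s - clamp a b t) <= Rabs (s - t).
Proof.
  unfold clamp, Rmin. destruct (Rle_dec b s), (Rle_dec b t); unfold Rmax;
  repeat match goal with |- context [Rle_dec ?x ?y] => destruct (Rle_dec x y) end;
  apply Rabs_le_between'; split_Rabs; lra.
Qed.

Lemma ccont_clamp (f : R -> C) (a b t : R) :
  0 <= a <= b -> continuous_on (fun s => 0 <= s <= b) f ->
  ccont (fun s => f (clamp a b s)) t.
Proof.
  intros Hab H.
  assert (Hin : forall s, 0 <= clamp a b s <= b).
  { intros s. assert (Hc := clamp_in a b s (proj2 Hab)). lra. }
  assert (Hc : filterlim (clamp a b) (locally t)
                 (within (fun s => 0 <= s <= b) (locally (clamp a b t)))).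
  { intros P [eps HP]. exists eps. intros s Hs. apply HP; [|apply Hin].
    change (Rabs (clamp a b s - clamp a b t) < eps).
    eapply Rle_lt_trans; [apply clamp_contract|]. exact Hs. }
  assert (Hf := filterlim_comp _ _ _ _ _ _ _ _ Hc (H _ (Hin t))).
  split.
  - apply (filterlim_comp _ _ _ (fun s => f (clamp a b s)) (fun z : C => fst z)
             _ _ _ Hf).
    apply (continuous_fst (U := R_UniformSpace) (V := R_UniformSpace)).
  - apply (filterlim_comp _ _ _ (fun s => f (clamp a b s)) (fun z : C => snd z)
             _ _ _ Hf).
    apply (continuous_snd (U := R_UniformSpace) (V := R_UniformSpace)).
Qed.

Lemma cderive_clamp (f : R -> C) (a b t : R) (d : C) :
  a < t < b -> cderive f t d -> cderive (fun s => f (clamp a b s)) t d.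
Proof.
  intros Ht.
  assert (Hl : locally t (fun s => a < s < b)).
  { apply (locally_interval _ t a b); simpl; try lra. intros; lra. }
  intros [H1 H2]; split;
  (eapply is_derive_ext_loc; [|eassumption]); revert Hl; apply filter_imp;
  intros s Hs; now rewrite clamp_id by lra.
Qed.

(** A comparison form of the fundamental theorem that needs the derivative only inside
    the interval: by the mean value theorem, [Phi - int r] is nonincreasing. *)
Lemma increment_le_RInt (Phi phi r : R -> R) (a b : R) :
  a < b ->
  (forall t, continuous Phi t) -> (forall t, continuous r t) ->
  (forall t, a < t < b -> is_derive Phi t (phi t)) ->
  (forall t, a < t < b -> phi t <= r t) ->
  Phi b - Phi a <= RInt r a b.
Proof.
  intros Hab HPhi Hr Hd Hle.
  assert (Hint : forall x y, ex_RInt r x y)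
    by (intros; apply (ex_RInt_continuous (V := R_CompleteNormedModule)); intros; apply Hr).
  assert (HdI : forall t, is_derive (fun x => RInt r a x) t (r t)).
  { intros t. apply (is_derive_RInt (V := R_NormedModule) r (fun x => RInt r a x) a t);
      [|apply Hr].
    apply filter_forall. intros x.
    apply (RInt_correct (V := R_CompleteNormedModule)), Hint. }
  (* the intermediate point may be an end point, where [phi] is arbitrary; hence the
     truncation at 0 *)
  destruct (MVT_gen (fun x => Phi x - RInt r a x) a b (fun x => Rmin (phi x - r x) 0))
    as [c [_ Hc]].
  - intros x Hx. rewrite Rmin_left, Rmax_right in Hx by lra.
    rewrite Rmin_left by (specialize (Hle x Hx); lra).
    exact (is_derive_minus _ _ _ _ _ (Hd x Hx) (HdI x)).
  - intros x _. apply continuity_pt_filterlim.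
    apply (continuous_minus Phi (fun x => RInt r a x)); [apply HPhi|].
    apply (ex_derive_continuous (fun x => RInt r a x)). exists (r x). apply HdI.
  - replace (RInt r a a) with 0 in Hc by (symmetry; apply (RInt_point a r)).
    assert (Rmin (phi c - r c) 0 <= 0) by apply Rmin_r. nra.
Qed.

(** * One step of the scheme *)

(** [V] is the derivative of [w] inside the interval, extended continuously. *)
Definition smooth_path (N : nat) (a b : R) (w V : R -> grid_fun) : Prop :=
  (forall t, path_cont N w t) /\ (forall t, path_cont N V t) /\
  (forall t, a < t < b -> path_deriv N w t (V t)).

(** The scheme yields only a pointwise derivative on [(a, b]].  Applying the inverse of
    [1 + A tau^2 Delta^2] to the equation expresses it through continuous quantities.
    The last conclusion is the equation tested with the derivative. *)
Lemma step_regularity (L eps A tau : R) (N : nat) (a b : R) (u g : R -> grid_fun) :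
  0 < L -> (0 < N)%nat -> 0 <= A * tau ^ 2 -> 0 <= a < b ->
  (forall i j, continuous_on (fun t => 0 <= t <= b) (fun t => u t i j)) ->
  (forall t, path_cont N g t) ->
  solves_step L eps A tau N a b u g ->
  exists V,
    smooth_path N a b (fun t => u (clamp a b t)) V /\
    (forall t i j, a < t < b -> is_node N i -> is_node N j ->
       time_deriv u t i j = V t i j) /\
    (forall t, a < t < b ->
       time_deriv (fun s => laplacian L N (u s)) t = laplacian L N (V t)) /\
    (forall t, a < t < b ->
       ip L N (V t) (V t)
       + A * tau ^ 2 * ip L N (laplacian L N (V t)) (laplacian L N (V t)) =
       - eps ^ 2 * ip L N (laplacian L N (u t)) (laplacian L N (V t))
       - ip L N (g t) (V t)).
Proof.
  intros HL HN Hc Hab Hu Hg Hstep.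
  set (c := A * tau ^ 2) in *.
  set (w := fun t => u (clamp a b t)).
  set (V := fun t => resolvent L N c
              (gsub (gscal (- eps ^ 2) (bilaplacian L N (w t))) (g t))).
  assert (Hw : forall t, path_cont N w t).
  { intros t i j _ _. apply (ccont_clamp (fun t => u t i j)); [lra|apply Hu]. }
  assert (HV : forall t, path_cont N V t).
  { intros t. apply path_cont_fourier_mult. intros i j Hi Hj. unfold gsub, gscal.
    apply (ccont_ext (fun s => RtoC (- eps ^ 2) * bilaplacian L N (w s) i j
                               + RtoC (-1) * g s i j)%C); [intros s; ring|].
    apply ccont_plus; apply ccont_mult; try apply ccont_const.
    - exact (path_cont_laplacian L N _ t (path_cont_laplacian L N w t (Hw t)) i j Hi Hj).
    - now apply Hg. }
  (* where the scheme prescribes the derivative, it coincides with [V] at the nodes *)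
  assert (Hkey : forall t, a < t < b -> path_deriv N u t (V t) /\
    forall h, ip L N (gadd (V t) (gscal c (bilaplacian L N (V t)))) h =
              ip L N (gsub (gscal (- eps ^ 2) (bilaplacian L N (u t))) (g t)) h).
  { intros t Ht.
    destruct (Hstep t ltac:(lra)) as [du [dbu [Hdu [Hdbu Heq]]]].
    assert (Hpd : path_deriv N u t du).
    { intros i j _ _. apply (is_time_deriv_interior b); [lra|exact Hdu]. }
    assert (Edbu : dbu = bilaplacian L N du).
    { extensionality i; extensionality j.
      apply (cderive_unique (fun s => bilaplacian L N (u s) i j) t).
      - apply (is_time_deriv_interior b (fun s => bilaplacian L N (u s))); [lra|exact Hdbu].
      - unfold bilaplacian. rewrite laplacian_mult.
        eapply cderive_ext; [intros s; rewrite laplacian_mult; reflexivity|].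
        apply (cderive_fourier_mult L N _ (fun s => laplacian L N (u s))).
        now apply path_deriv_laplacian. }
    subst dbu.
    assert (Heq' : gadd du (gscal c (bilaplacian L N du)) =
                   gsub (gscal (- eps ^ 2) (bilaplacian L N (u t))) (g t)).
    { extensionality i; extensionality j. apply Heq. }
    assert (HVdu : forall i j, is_node N i -> is_node N j -> V t i j = du i j).
    { intros i j Hi Hj. unfold V, w. rewrite clamp_id by lra.
      rewrite <- Heq'. now apply resolvent_spec. }
    split.
    - intros i j Hi Hj. rewrite HVdu by assumption. now apply Hpd.
    - intros h. rewrite <- Heq'. apply ip_ext_l; intros i j Hi Hj.
      unfold gadd. rewrite HVdu by assumption. unfold bilaplacian.
      rewrite !(laplacian_mult L N (V t)), (fourier_mult_ext L N _ (V t) du HVdu).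
      now rewrite <- laplacian_mult. }
  exists V. split; [split; [exact Hw|split; [exact HV|]]|split; [|split]].
  - intros t Ht i j Hi Hj. apply (cderive_clamp (fun s => u s i j)); [exact Ht|].
    now apply Hkey.
  - intros t i j Ht Hi Hj. apply time_deriv_eq. now apply Hkey.
  - intros t Ht. extensionality i; extensionality j. apply time_deriv_eq.
    rewrite laplacian_mult.
    apply (cderive_ext (fun s => fourier_mult L N (fun k l => RtoC (lap_symbol L k l)) (u s) i j)).
    + intros s. now rewrite laplacian_mult.
    + now apply cderive_fourier_mult, Hkey.
  - intros t Ht. destruct (Hkey t Ht) as [_ H]. specialize (H (V t)).
    rewrite ip_add, ip_sub, !ip_scal in H. unfold bilaplacian in H.
    rewrite !(ip_laplacian L N (laplacian L N _)) in H by exact HN. exact H.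
Qed.

(** Turns a pointwise bound on [phi] into a bound by the two dissipation integrals
    of the theorem. *)
Lemma increment_le_dissipation (L : R) (N : nat) (a b c1 c2 : R)
    (w V : R -> grid_fun) (Phi phi : R -> R) :
  a < b -> smooth_path N a b w V ->
  (forall t, continuous Phi t) ->
  (forall t, a < t < b -> is_derive Phi t (phi t)) ->
  (forall t, a < t < b -> phi t <= c1 * ip L N (V t) (V t)
     + c2 * ip L N (laplacian L N (V t)) (laplacian L N (V t))) ->
  Phi b - Phi a <=
    c1 * RInt (fun t => ip L N (V t) (V t)) a b
    + c2 * RInt (fun t => ip L N (laplacian L N (V t)) (laplacian L N (V t))) a b.
Proof.
  intros Hab [Hw [HV Hd]] HPhi HdPhi Hle.
  assert (C1 : forall t, continuous (fun t => ip L N (V t) (V t)) t)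
    by (intros t; apply continuous_ip; apply HV).
  assert (C2 : forall t, continuous
            (fun t => ip L N (laplacian L N (V t)) (laplacian L N (V t))) t)
    by (intros t; apply continuous_ip; apply path_cont_laplacian, HV).
  assert (Hex : forall f : R -> R, (forall t, continuous f t) -> ex_RInt f a b)
    by (intros f Hf; apply (ex_RInt_continuous (V := R_CompleteNormedModule)); intros; apply Hf).
  set (q1 := fun t => ip L N (V t) (V t)) in *.
  set (q2 := fun t => ip L N (laplacian L N (V t)) (laplacian L N (V t))) in *.
  replace (c1 * RInt q1 a b + c2 * RInt q2 a b)
    with (RInt (fun t => c1 * q1 t + c2 * q2 t) a b).
  - apply (increment_le_RInt Phi phi); try assumption.
    intros t. apply (continuous_plus (fun t => c1 * q1 t) (fun t => c2 * q2 t)).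
    + apply (continuous_mult (fun _ => c1) q1); [apply continuous_const|apply C1].
    + apply (continuous_mult (fun _ => c2) q2); [apply continuous_const|apply C2].
  - apply is_RInt_unique.
    apply (is_RInt_plus (V := R_NormedModule) (fun t => c1 * q1 t) (fun t => c2 * q2 t)).
    + apply (is_RInt_scal (V := R_NormedModule) q1).
      apply (RInt_correct (V := R_CompleteNormedModule)), Hex, C1.
    + apply (is_RInt_scal (V := R_NormedModule) q2).
      apply (RInt_correct (V := R_CompleteNormedModule)), Hex, C2.
Qed.

Lemma ip_pair_young (L : R) (N : nat) (c : R) (F G : grid_fun * grid_fun) :
  2 * c * ip_pair L N F G <= c ^ 2 * ip_pair L N F F + ip_pair L N G G.
Proof.
  unfold ip_pair.
  assert (H1 := ip_nonneg L N (gadd (fst G) (gscal (- c) (fst F)))).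
  assert (H2 := ip_nonneg L N (gadd (snd G) (gscal (- c) (snd F)))).
  rewrite !ip_lin, !ip_lin_r in H1, H2.
  rewrite (ip_sym L N (fst G) (fst F)) in H1. rewrite (ip_sym L N (snd G) (snd F)) in H2.
  lra.
Qed.

(** With [D] the increment of [w], the function [2 (grad D, grad w(t)) - (t - a) |grad D|^2/tau]
    grows by [|grad D|^2] over the step, while by Young's inequality its derivative is
    at most [tau |grad V|^2].  This avoids integrating vector-valued functions. *)
Lemma grad_increment (L : R) (N : nat) (a tau : R) (w V : R -> grid_fun) :
  0 < L -> (0 < N)%nat -> 0 < tau -> smooth_path N a (a + tau) w V ->
  let G := grad L N (gsub (w (a + tau)) (w a)) in
  ip_pair L N G G <=
    (3 - sqrt 3) / 2 * RInt (fun t => ip L N (V t) (V t)) a (a + tau)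
    + (3 + sqrt 3) / 12 * tau ^ 2
      * RInt (fun t => ip L N (laplacian L N (V t)) (laplacian L N (V t))) a (a + tau).
Proof.
  intros HL HN Htau HwV G. set (b := a + tau) in *.
  set (D := gsub (w b) (w a)). set (K := ip_pair L N G G).
  assert (HwV' := HwV). destruct HwV' as [Hw [HV Hd]].
  assert (HG : forall f, ip_pair L N G (grad L N f) = - ip L N (laplacian L N D) f).
  { intros f. unfold G. rewrite ip_grad by assumption. fold D.
    now rewrite ip_laplacian. }
  set (Phi := fun t => -2 * ip L N (laplacian L N D) (w t) - (t - a) * (K / tau)).
  assert (H := increment_le_dissipation L N a b ((3 - sqrt 3) / 2) ((3 + sqrt 3) / 12 * tau ^ 2)
    w V Phi (fun t => -2 * ip L N (laplacian L N D) (V t) - K / tau)).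
  assert (E : Phi b - Phi a = K).
  { unfold Phi. replace (b - a) with tau by (unfold b; ring).
    assert (EK : K = - ip L N (laplacian L N D) (w b) + ip L N (laplacian L N D) (w a)).
    { unfold K at 1. unfold G at 2. rewrite HG.
      rewrite (ip_sym L N _ (gsub _ _)), ip_sub, !(ip_sym L N _ (laplacian L N D)). ring. }
    replace (tau * (K / tau)) with K by (field; lra). lra. }
  rewrite E in H. apply H; clear H.
  - unfold b; lra.
  - exact HwV.
  - intros t. unfold Phi.
    apply (continuous_minus (fun t => -2 * ip L N (laplacian L N D) (w t))
                            (fun t => (t - a) * (K / tau))).
    + apply (continuous_mult (fun _ => -2) (fun t => ip L N (laplacian L N D) (w t)));
      [apply continuous_const|]. apply continuous_ip; [apply path_cont_const|apply Hw].
    + apply (ex_derive_continuous (fun t => (t - a) * (K / tau))). auto_derive; exact I.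
  - intros t Ht. unfold Phi.
    assert (H1 := is_derive_ip_const L N (laplacian L N D) w (V t) t (Hd t Ht)).
    assert (Haux : forall q : R -> R, forall dq, is_derive q t dq ->
              is_derive (fun s => -2 * q s - (s - a) * (K / tau)) t (-2 * dq - K / tau)).
    { intros q dq Hq. auto_derive; [repeat split; exists dq; exact Hq|].
      replace (Derive (fun x : R => q x) t) with dq
        by (symmetry; exact (is_derive_unique q t dq Hq)). field. lra. }
    exact (Haux _ _ H1).
  - intros t Ht. assert (HY := ip_pair_young L N (/ tau) G (grad L N (V t))).
    rewrite HG in HY. fold K in HY.
    assert (HI := grad_interpolation L N tau (V t) HL HN). cbv zeta in HI.
    apply (Rmult_le_compat_l tau) in HY; [|lra].
    replace (tau * (2 * / tau * - ip L N (laplacian L N D) (V t)))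
      with (-2 * ip L N (laplacian L N D) (V t)) in HY by (field; lra).
    replace (tau * ((/ tau) ^ 2 * K + ip_pair L N (grad L N (V t)) (grad L N (V t))))
      with (K / tau + tau * ip_pair L N (grad L N (V t)) (grad L N (V t))) in HY
      by (field; lra).
    lra.
Qed.

(** The energy balance of one step started at [v], with extrapolation from [p];
    the multiple of the squared gradient of [v - p] is what the previous step pays for. *)
Lemma step_energy (L eps A tau : R) (N : nat) (a : R) (v p : grid_fun) (w V : R -> grid_fun) :
  0 < L -> (0 < N)%nat -> 0 < tau ->
  smooth_path N a (a + tau) w V -> w a = v ->
  (forall t, a < t < a + tau ->
     ip L N (V t) (V t)
     + A * tau ^ 2 * ip L N (laplacian L N (V t)) (laplacian L N (V t)) =
     - eps ^ 2 * ip L N (laplacian L N (w t)) (laplacian L N (V t))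
     - ip L N (fNL L N tau (t - a) v p) (V t)) ->
  let G := grad L N (gsub v p) in
  energy L eps N (w (a + tau)) - energy L eps N v <=
    - (sqrt 3 - 1) / 4 * RInt (fun t => ip L N (V t) (V t)) a (a + tau)
    + ((7 + 3 * sqrt 3) / 24 - A) * tau ^ 2
      * RInt (fun t => ip L N (laplacian L N (V t)) (laplacian L N (V t))) a (a + tau)
    + sqrt 3 / 6 * ip_pair L N G G.
Proof.
  intros HL HN Htau HwV Hwa Htest G. set (b := a + tau) in *. set (K := ip_pair L N G G).
  assert (HwV' := HwV). destruct HwV' as [Hw [HV Hd]].
  assert (H3 : sqrt 3 * sqrt 3 = 3) by (apply sqrt_sqrt; lra).
  assert (Hs3 : 0 < sqrt 3) by (apply sqrt_lt_R0; lra).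
  set (lap2 := fun t => ip L N (laplacian L N (w t)) (laplacian L N (w t))).
  (* the cubic term integrates the quadratic weight that Young's inequality puts on
     the previous gradient increment *)
  set (Phi := fun t => eps ^ 2 / 2 * lap2 t + ip L N (fN L N v) (w t)
                       - sqrt 3 / (6 * tau ^ 3) * K * (t - a) ^ 3).
  set (phi := fun t => eps ^ 2 * ip L N (laplacian L N (w t)) (laplacian L N (V t))
                       + ip L N (fN L N v) (V t)
                       - sqrt 3 / (2 * tau ^ 3) * K * (t - a) ^ 2).
  assert (H := increment_le_dissipation L N a b ((sqrt 3 - 1) / 4 - 1)
                 (((sqrt 3 + 1) / 24 - A) * tau ^ 2) w V Phi phi).
  assert (HPhi : Phi b - Phi a =
    eps ^ 2 / 2 * lap2 b - eps ^ 2 / 2 * lap2 a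
    + ip L N (fN L N v) (gsub (w b) v) - sqrt 3 / 6 * K).
  { unfold Phi. replace (b - a) with tau by (unfold b; ring).
    rewrite (ip_sym L N _ (gsub _ _)), ip_sub, !(ip_sym L N _ (fN L N v)), Hwa.
    field. lra. }
  rewrite HPhi in H.
  assert (HP := potential_increment L N v (w b) HN). cbv zeta in HP.
  assert (HI := grad_increment L N a tau w V HL HN Htau HwV). cbv zeta in HI.
  fold b in HI. rewrite Hwa in HI.
  rewrite !energy_split. unfold lap2 in H. rewrite Hwa in H.
  enough (Hgoal :
    eps ^ 2 / 2 * ip L N (laplacian L N (w b)) (laplacian L N (w b))
    - eps ^ 2 / 2 * ip L N (laplacian L N v) (laplacian L N v)
    + ip L N (fN L N v) (gsub (w b) v) - sqrt 3 / 6 * K <=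
    ((sqrt 3 - 1) / 4 - 1) * RInt (fun t => ip L N (V t) (V t)) a b
    + ((sqrt 3 + 1) / 24 - A) * tau ^ 2
      * RInt (fun t => ip L N (laplacian L N (V t)) (laplacian L N (V t))) a b) by lra.
  apply H; clear H HP HI HPhi.
  - unfold b; lra.
  - exact HwV.
  - intros t. unfold Phi.
    apply (continuous_minus (fun t => eps ^ 2 / 2 * lap2 t + ip L N (fN L N v) (w t))
             (fun t => sqrt 3 / (6 * tau ^ 3) * K * (t - a) ^ 3)).
    + apply (continuous_plus (fun t => eps ^ 2 / 2 * lap2 t)
               (fun t => ip L N (fN L N v) (w t))).
      * apply (continuous_mult (fun _ => eps ^ 2 / 2) lap2); [apply continuous_const|].
        apply continuous_ip; apply path_cont_laplacian, Hw.
      * apply continuous_ip; [apply path_cont_const|apply Hw].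
    + apply (ex_derive_continuous (fun t => sqrt 3 / (6 * tau ^ 3) * K * (t - a) ^ 3)).
      auto_derive; exact I.
  - intros t Ht.
    assert (H1 := is_derive_ip_const L N (fN L N v) w (V t) t (Hd t Ht)).
    assert (Hl := path_deriv_laplacian L N w (V t) t (Hd t Ht)).
    assert (H2 := is_derive_ip L N _ _ _ _ t Hl Hl). fold lap2 in H2.
    assert (Haux : forall q1 q2 : R -> R, forall d1 d2, is_derive q1 t d1 -> is_derive q2 t d2 ->
      is_derive (fun s => eps ^ 2 / 2 * q1 s + q2 s - sqrt 3 / (6 * tau ^ 3) * K * (s - a) ^ 3)
        t (eps ^ 2 / 2 * d1 + d2 - sqrt 3 / (2 * tau ^ 3) * K * (t - a) ^ 2)).
    { intros q1 q2 d1 d2 Hq1 Hq2. auto_derive.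
      - repeat split; [exists d1; exact Hq1|exists d2; exact Hq2].
      - replace (Derive (fun x : R => q1 x) t) with d1
          by (symmetry; exact (is_derive_unique q1 t d1 Hq1)).
        replace (Derive (fun x : R => q2 x) t) with d2
          by (symmetry; exact (is_derive_unique q2 t d2 Hq2)). field. lra. }
    specialize (Haux _ _ _ _ H2 H1). unfold Phi, phi.
    rewrite (ip_sym L N (laplacian L N (V t))) in Haux.
    replace (eps ^ 2 * ip L N (laplacian L N (w t)) (laplacian L N (V t))) with
      (eps ^ 2 / 2 * (ip L N (laplacian L N (w t)) (laplacian L N (V t))
                      + ip L N (laplacian L N (w t)) (laplacian L N (V t)))) by field.
    exact Haux.
  - intros t Ht. specialize (Htest t Ht). unfold phi.
    set (F := gsub_pair (flux L N v) (flux L N p)).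
    assert (HNL : ip L N (fNL L N tau (t - a) v p) (V t) =
      ip L N (fN L N v) (V t) - (t - a) / tau * ip_pair L N F (grad L N (V t))).
    { unfold fNL. rewrite ip_add, ip_scal, ip_sub, !fN_flux, !ip_div by exact HN.
      unfold F, ip_pair, gsub_pair; cbn [fst snd]. rewrite !ip_sub. ring. }
    rewrite HNL in Htest.
    assert (HLip := flux_lipschitz L N v p). cbv zeta in HLip. fold F G K in HLip.
    assert (HY := ip_pair_young L N (sqrt 3 / tau * ((t - a) / tau)) F (grad L N (V t))).
    assert (HI := grad_interpolation L N tau (V t) HL HN). cbv zeta in HI.
    set (M := ip_pair L N (grad L N (V t)) (grad L N (V t))) in *.
    set (X := ip_pair L N F (grad L N (V t))) in *.
    set (F2 := ip_pair L N F F) in *.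
    (* scaled so that the Young weight on the new gradient is [sqrt 3 / 6 * tau] *)
    apply (Rmult_le_compat_l (sqrt 3 / 6 * tau)) in HY; [|nra].
    replace (sqrt 3 / 6 * tau * (2 * (sqrt 3 / tau * ((t - a) / tau)) * X))
      with (sqrt 3 * sqrt 3 / 3 * ((t - a) / tau * X)) in HY by (field; lra).
    replace (sqrt 3 / 6 * tau * ((sqrt 3 / tau * ((t - a) / tau)) ^ 2 * F2 + M))
      with (sqrt 3 * sqrt 3 * sqrt 3 / 6 / tau ^ 3 * (t - a) ^ 2 * F2
            + sqrt 3 / 6 * (tau * M)) in HY by (field; lra).
    rewrite H3 in HY.
    assert (Hc : 0 <= 3 * sqrt 3 / 6 / tau ^ 3 * (t - a) ^ 2).
    { apply Rmult_le_pos; [|apply pow2_ge_0].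
      apply Rlt_le, Rdiv_lt_0_compat; [lra|]. now apply pow_lt. }
    apply (Rmult_le_compat_l _ _ _ Hc) in HLip.
    replace (sqrt 3 / (2 * tau ^ 3) * K * (t - a) ^ 2)
      with (3 * sqrt 3 / 6 / tau ^ 3 * (t - a) ^ 2 * K) by (field; lra).
    apply (Rmult_le_compat_l (sqrt 3 / 6)) in HI; [|lra].
    set (v1 := ip L N (V t) (V t)) in *.
    set (v2 := ip L N (laplacian L N (V t)) (laplacian L N (V t))) in *.
    replace (sqrt 3 / 6 * ((3 - sqrt 3) / 2 * v1 + (3 + sqrt 3) / 12 * tau ^ 2 * v2))
      with ((3 * sqrt 3 - sqrt 3 * sqrt 3) / 12 * v1
            + (3 * sqrt 3 + sqrt 3 * sqrt 3) / 72 * tau ^ 2 * v2) in HI by field.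
    rewrite H3 in HI. lra.
Qed.

(** * Energy stability *)

Lemma path_cont_fNL (L : R) (N : nat) (tau a : R) (v p : grid_fun) (t : R) :
  path_cont N (fun s => fNL L N tau (s - a) v p) t.
Proof.
  intros i j _ _. unfold fNL, gadd, gscal.
  apply ccont_plus; [apply ccont_const|]. apply ccont_mult; [|apply ccont_const].
  split; simpl.
  - apply (ex_derive_continuous (fun s => (s - a) / tau)). auto_derive; exact I.
  - apply continuous_const.
Qed.

Lemma RInt_gnorm_eq (L : R) (N : nat) (a b : R) (f V : R -> grid_fun) :
  a < b ->
  (forall t i j, a < t < b -> is_node N i -> is_node N j -> f t i j = V t i j) ->
  RInt (fun t => gnorm L N (f t) ^ 2) a b = RInt (fun t => ip L N (V t) (V t)) a b.
Proof.
  intros Hab H. apply RInt_ext. intros t Ht.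
  rewrite Rmin_left, Rmax_right in Ht by lra.
  rewrite gnorm_sq, (ip_ext_l L N (f t) (V t)), (ip_sym L N (V t)), (ip_ext_l L N (f t) (V t));
  auto.
Qed.

Theorem theorem3p1 (L eps T A : R) (N Nt : nat) (u : nat -> R -> grid_fun)
    (hL : 0 < L) (heps : 0 < eps) (hT : 0 < T)
    (hN : (0 < N)%nat) (hNt : (0 < Nt)%nat)
    (hA0 : 0 < A) (hA : A >= (2 + sqrt 3) / 6)
    (hu : sETDMs2 L eps A T N Nt u) :
  forall n : nat, (1 <= n <= Nt - 1)%nat ->
    modified_energy L eps T N Nt u (S n)
    + (A - (2 + sqrt 3) / 6) * tstep T Nt ^ 2
      * RInt (fun t => gnorm L N (time_deriv (fun s => laplacian L N (u (S n) s)) t) ^ 2)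
             (tnode T Nt n) (tnode T Nt (S n))
    <= modified_energy L eps T N Nt u n.
Proof.
  intros n Hn. destruct n as [|m]; [lia|].
  destruct hu as [_ Hcont Hext Hfirst Hnext].
  set (tau := tstep T Nt) in *.
  assert (Htau : 0 < tau).
  { apply Rdiv_lt_0_compat; [exact hT|]. now apply lt_0_INR. }
  assert (Hc : 0 <= A * tau ^ 2).
  { apply Rmult_le_pos; [lra|apply pow2_ge_0]. }
  assert (HtS : forall k, tnode T Nt (S k) = tnode T Nt k + tau).
  { intros k. unfold tnode. rewrite S_INR. unfold tau. ring. }
  assert (Ht0 : forall k, 0 <= tnode T Nt k).
  { intros k. apply Rmult_le_pos; [apply pos_INR|]. apply Rlt_le, Htau. }
  set (a' := tnode T Nt m) in *. set (a := tnode T Nt (S m)) in *.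
  set (b := tnode T Nt (S (S m))) in *.
  assert (Ea : a = a' + tau) by apply HtS. assert (Eb : b = a + tau) by apply HtS.
  assert (Ha' : 0 <= a') by apply Ht0.
  set (v := u (S m) a). set (p := u m a').
  assert (Hv : u (S (S m)) a = v).
  { extensionality i; extensionality j. apply Hext; [lia|]. fold a. lra. }
  assert (Hp : u (S m) a' = p).
  { extensionality i; extensionality j. apply Hext; [lia|]. fold a'. lra. }
  (* the step before: its source term matters only through its continuity *)
  assert (Hprev : exists g, (forall t, path_cont N g t) /\
                    solves_step L eps A tau N a' a (u (S m)) g).
  { destruct m as [|m'].
    - eexists; split; [|exact Hfirst]. intros t; apply path_cont_const.
    - eexists; split; [|apply (Hnext (S m')); lia]. intros t; apply path_cont_fNL. }
  destruct Hprev as [g [Hg Hprev]].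
  destruct (step_regularity L eps A tau N a' a (u (S m)) g) as [V' [HV' [Hd' [Hl' _]]]];
    try assumption; [lra|apply Hcont; lia|].
  assert (Hstep := Hnext (S m) ltac:(lia) ltac:(lia)).
  replace (S m - 1)%nat with m in Hstep by lia. fold a b v a' p in Hstep.
  destruct (step_regularity L eps A tau N a b (u (S (S m)))
              (fun t => fNL L N tau (t - a) v p)) as [V [HV [Hd [Hl Htest]]]];
    try assumption; [lra|apply Hcont; lia|intros t; apply path_cont_fNL|].
  set (w' := fun t => u (S m) (clamp a' a t)) in *.
  set (w := fun t => u (S (S m)) (clamp a b t)) in *.
  assert (Hwa : w a = v) by (unfold w; rewrite clamp_id by lra; exact Hv).
  assert (Hwb : w b = u (S (S m)) b) by (unfold w; now rewrite clamp_id by lra).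
  assert (Hwa' : w' a' = p) by (unfold w'; rewrite clamp_id by lra; exact Hp).
  assert (Hwb' : w' a = v) by (unfold w'; now rewrite clamp_id by lra).
  unfold modified_energy, int_dt, int_dt_lap.
  replace (S (S m) - 1)%nat with (S m) by lia. replace (S m - 1)%nat with m by lia.
  fold tau a' a b.
  rewrite (RInt_gnorm_eq L N a b (fun t => time_deriv (u (S (S m))) t) V) by (auto; lra).
  rewrite (RInt_gnorm_eq L N a' a (fun t => time_deriv (u (S m)) t) V') by (auto; lra).
  rewrite (RInt_gnorm_eq L N a b
    (fun t => time_deriv (fun s => laplacian L N (u (S (S m)) s)) t)
    (fun t => laplacian L N (V t))) by (intros; try rewrite Hl; auto; lra).
  rewrite (RInt_gnorm_eq L N a' a
    (fun t => time_deriv (fun s => laplacian L N (u (S m) s)) t)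
    (fun t => laplacian L N (V' t))) by (intros; try rewrite Hl'; auto; lra).
  rewrite Ea in HV'. rewrite Eb in HV.
  assert (HG := grad_increment L N a' tau w' V' hL hN Htau HV').
  assert (HE := step_energy L eps A tau N a v p w V hL hN Htau HV Hwa).
  cbv zeta in HG, HE. rewrite <- Ea, Hwa', Hwb' in HG. rewrite <- Eb, Hwb in HE.
  assert (HE' := HE (fun t Ht => ltac:(unfold w; rewrite clamp_id by lra; exact (Htest t Ht)))).
  clear HE. fold v.
  (* paying for the gradient increment of the previous step takes its two
     integrals with exactly the weights they have in the modified energy *)
  assert (H3 : sqrt 3 * sqrt 3 = 3) by (apply sqrt_sqrt; lra).
  assert (Hs3 : 0 < sqrt 3) by (apply sqrt_lt_R0; lra).
  set (I1 := RInt (fun t => ip L N (V t) (V t)) a b) in *.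
  set (J1 := RInt (fun t => ip L N (laplacian L N (V t)) (laplacian L N (V t))) a b) in *.
  set (I0 := RInt (fun t => ip L N (V' t) (V' t)) a' a) in *.
  set (J0 := RInt (fun t => ip L N (laplacian L N (V' t)) (laplacian L N (V' t))) a' a) in *.
  apply (Rmult_le_compat_l (sqrt 3 / 6)) in HG; [|lra].
  replace (sqrt 3 / 6 * ((3 - sqrt 3) / 2 * I0 + (3 + sqrt 3) / 12 * tau ^ 2 * J0))
    with ((3 * sqrt 3 - sqrt 3 * sqrt 3) / 12 * I0
          + (3 * sqrt 3 + sqrt 3 * sqrt 3) / 72 * tau ^ 2 * J0) in HG by field.
  rewrite H3 in HG. lra.
Qed.
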